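(* Let $d\ge 1$ be an integer, let $m_1,\dots,m_d$ be positive integers, let $\alpha_1,\mu_1,\dots,\alpha_d,\mu_d\in(0,\infty)$, and let $\lambda_1,\dots,\lambda_d$ be non-zero real numbers. Consider $$F=-\sum_{i=1}^d\lambda_i\frac{m_i\alpha_i}{\mu_i}+\sum_{i=1}^d\lambda_i\,\gamma_i(m_i\alpha_i,\mu_i),$$ where $\gamma_1(m_1\alpha_1,\mu_1),\dots,\gamma_d(m_d\alpha_d,\mu_d)$ are independent random variables, $\gamma_i(m_i\alpha_i,\mu_i)$ having the Gamma law with parameters $(m_i\alpha_i,\mu_i)$. Let $Y$ be a real valued random variable with $\mathbb{E}[|Y|]<+\infty$. Then $Y$ and $F$ have the same law if and only if, for all $\phi\in S(\mathbb{R})$, $$\mathbb{E}\Bigg[\Big(Y+\sum_{i=1}^d\lambda_i\frac{m_i\alpha_i}{\mu_i}\Big)(-1)^d\Big(\prod_{j=1}^d\frac{\lambda_j}{\mu_j}\Big)\phi^{(d)}(Y)+\sum_{l=1}^{d-1}(-1)^l\bigg(Y\,e_l\Big(\frac{\lambda_1}{\mu_1},\dots,\frac{\lambda_d}{\mu_d}\Big)+\sum_{k=1}^d\lambda_k\frac{m_k\alpha_k}{\mu_k}\Big(e_l\Big(\frac{\lambda_1}{\mu_1},\dots,\frac{\lambda_d}{\mu_d}\Big)-e_l\Big(\Big(\frac{\lambda}{\mu}\Big)_k\Big)\Big)\bigg)\phi^{(l)}(Y)+Y\phi(Y)\Bigg]=0.$$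
   Context: For a tuple $(x_1,\dots,x_n)$ of real numbers and $1\le k\le n$, $e_k(x_1,\dots,x_n)=\sum_{1\le i_1<\dots<i_k\le n}x_{i_1}\cdots x_{i_k}$ is the elementary symmetric polynomial of order $k$, and $e_0=1$ by convention. For $k\in\{1,\dots,d\}$, $\left(\frac{\lambda}{\mu}\right)_k$ denotes the $(d-1)$-tuple $\left(\frac{\lambda_1}{\mu_1},\dots,\frac{\lambda_{k-1}}{\mu_{k-1}},\frac{\lambda_{k+1}}{\mu_{k+1}},\dots,\frac{\lambda_d}{\mu_d}\right)$. The Gamma law with parameters $(\alpha,\mu)\in(0,\infty)^2$ has density $x\mapsto\frac{\mu^\alpha}{\Gamma(\alpha)}x^{\alpha-1}e^{-\mu x}$ on $(0,\infty)$. $S(\mathbb{R})$ is the Schwartz space of rapidly decreasing smooth functions, and $\phi^{(l)}$ is the $l$-th derivative. For $d=1$ the sum over $l$ is empty. *)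

(* Defs.v *)
From HB Require Import structures.
From mathcomp Require Import all_boot all_order all_algebra.
From mathcomp Require Import all_classical all_reals all_analysis.
(* [mpoly] is not imported: its notations clash with those of [all_analysis]. *)
From mathcomp Require mpoly.

Set Implicit Arguments.
Unset Strict Implicit.
Unset Printing Implicit Defensive.

Import Order.TTheory GRing.Theory Num.Theory.
Import numFieldNormedType.Exports.

Local Open Scope classical_set_scope.
Local Open Scope ring_scope.

Definition elem_sym (R : realType) (n k : nat) (x : 'I_n -> R) : R :=
  mpoly.meval x (mpoly.mesym n R k).

Definition omit (R : realType) (n : nat) (x : 'I_n -> R) (k : 'I_n) :
    'I_n.-1 -> R :=
  fun j => x (lift k j).

Definition schwartz (R : realType) (phi : R -> R) : Prop :=
  (forall (n : nat) (x : R), derivable (derive1n n phi) x 1) /\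
  (forall k n : nat, exists C : R,
     forall x : R, `|x| ^+ k * `|derive1n n phi x| <= C).

Definition gamma_function (R : realType) (a : R) : R :=
  \int[lebesgue_measure]_(x in `]0, +oo[) (x `^ (a - 1) * expR (- x)).

Definition gamma_density (R : realType) (a b x : R) : R :=
  if 0 < x then b `^ a / gamma_function a * x `^ (a - 1) * expR (- (b * x))
  else 0.

Definition has_gamma_law (R : realType) (disp : measure_display)
    (T : measurableType disp) (P : probability T R) (X : {RV P >-> R})
    (a b : R) : Prop :=
  forall A : set R, measurable A ->
    (distribution P X A =
       \int[lebesgue_measure]_(x in A) (gamma_density a b x)%:E)%E.

Definition independent_RVs (R : realType) (disp : measure_display)
    (T : measurableType disp) (P : probability T R) (I : finType)
    (X : I -> {RV P >-> R}) : Prop :=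
  forall (J : {set I}) (B : I -> set R),
    (forall i, measurable (B i)) ->
    (P (\bigcap_(i in [set i | i \in J]) (X i @^-1` B i)) =
       \prod_(i in J) P (X i @^-1` B i))%E.

(* The two variables may live on different probability spaces; equality is
   required on measurable sets only, a measure being unconstrained elsewhere. *)
Definition same_law (R : realType) (disp1 disp2 : measure_display)
    (T1 : measurableType disp1) (P1 : probability T1 R) (X1 : {RV P1 >-> R})
    (T2 : measurableType disp2) (P2 : probability T2 R) (X2 : {RV P2 >-> R}) :
    Prop :=
  forall A : set R, measurable A ->
    distribution P1 X1 A = distribution P2 X2 A.

(* Main.v *)
(** Put c_k = lambda_k / mu_k, a_k = m_k alpha_k, P = prod_k (1 - c_k D), with D the
    derivative, and P_k = P / (1 - c_k D).  Shifting by the mean, the expression in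
    the theorem says that X (the variable plus its shift) satisfies
      E[X (P phi)(X)] = sum_k a_k c_k E[(P_k phi)(X)].
    Integration by parts against the gamma density gives this for
    sum_k lambda_k gamma_k, one independent summand at a time.

    Conversely the identity extends from Schwartz functions to the class of smooth
    functions all of whose derivatives are bounded, by cutting off.  On that class
    let W = prod_k (1 - c_k D)^(a_k), realised as (1 - c_k D)^(n+1) composed with
    averaging against a gamma weight of parameter n + 1 - a_k >= 1.  Commuting W with
    multiplication by x gives W (x chi) = x W chi - sum_k a_k c_k (W chi)/(1 - c_k D),
    whose expectation at X vanishes by the identity with phi = W chi / P.  Since
    eta - eta(0) = x chi by Hadamard's lemma, E[(W eta)(X)] = K eta(0) with K <> 0
    independent of X.  If F satisfies the identity too and A h (x) = E[h(x + F)], then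
    translating gives W A h = A W h = K h, hence
    K E[h(X)] = E[(W A h)(X)] = K E[h(F)]. *)

Require Import Defs.
From HB Require Import structures.
From mathcomp Require Import all_boot all_order all_algebra.
From mathcomp Require Import all_classical all_reals all_analysis.
From mathcomp Require Import measurable_realfun ring.
From mathcomp Require mpoly.

Set Implicit Arguments.
Unset Strict Implicit.
Unset Printing Implicit Defensive.

Import Order.TTheory GRing.Theory Num.Theory.
Import numFieldNormedType.Exports.

Local Open Scope classical_set_scope.
Local Open Scope ring_scope.

(** * Smooth functions with bounded derivatives *)

Section smooth_bounded.
Context {R : realType}.
Implicit Types (f g : R -> R) (a b c x : R).

(** On exponentials e^(iux) the operator W acts as multiplication by K prod_k (1 - i c_k u)^(a_k),
    that is, by K over the characteristic function of the uncentred variable. So E[(W eta)(X)] = K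
    eta(0) is the Fourier form of the theorem, reached without complex numbers or a differential
    equation in u. Schwartz functions are too few for this route: constants are needed to read off
    K, and the quotient chi of a Schwartz function eta behaves like -eta(0)/x at infinity. Bounded
    derivatives of all orders survive averaging and Hadamard's lemma, and a finite first moment
    makes X phi(X) integrable for them. No division by P takes place: for each k one factor 1 - c_k
    D is kept apart from the operator V_k, a multiple of (1 - c_k D)^(a_k - 1), and phi is the
    product of the V_k applied to chi. The weight parameter n + 1 - a_k is kept at least 1 because
    the weight is then bounded near 0 and dominated by an exponential. The laws themselves may have
    a_k < 1; for them integrability is read off from the total mass 1. *)

Definition smooth_in (B : set (R -> R)) f := forall n : nat,
  (forall x, derivable (derive1n n f) x 1) /\ B (derive1n n f).

(** Coinduction: a family of formulas closed under differentiation is checked one derivative at a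
    time, so no closed form of an n-th derivative is ever written. *)
Lemma smooth_in_coind (B S : set (R -> R)) :
    (forall f, S f ->
      [/\ forall x, derivable f x 1, B f & S (derive1 f)]) ->
  S `<=` smooth_in B.
Proof.
move=> HS f Sf n.
have : S (derive1n n f).
  by elim: n => // n IH; rewrite derive1nS; have [] := HS _ IH.
by move=> /HS[].
Qed.

Lemma smooth_inP (B : set (R -> R)) f : smooth_in B f ->
  [/\ forall x, derivable f x 1, B f & smooth_in B (derive1 f)].
Proof.
move=> sf; split; [exact: (sf 0).1|exact: (sf 0).2|move=> n].
by rewrite -derive1Sn; exact: sf.
Qed.

Definition unif_bounded f := exists C, forall x, `|f x| <= C.

Definition decaying f :=
  forall k : nat, exists C, forall x, `|x| ^+ k * `|f x| <= C.

Definition smooth_bounded := smooth_in unif_bounded.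

Lemma schwartzP f : schwartz f <-> smooth_in decaying f.
Proof.
split=> [[df bf] n|sf]; first by split=> [x|k]; [exact: df|exact: bf].
by split=> [n x|k n]; [exact: (sf n).1|exact: (sf n).2].
Qed.

Lemma schwartz_smooth_bounded f : schwartz f -> smooth_bounded f.
Proof.
move=> /schwartzP sf n; have [df bf] := sf n; split=> //.
by have [C HC] := bf 0%N; exists C => x; rewrite -[leLHS]mul1r -(expr0 `|x|).
Qed.

Lemma sb_derivable f x : smooth_bounded f -> derivable f x 1.
Proof. by move=> /smooth_inP[]. Qed.

Lemma sb_bounded f : smooth_bounded f -> unif_bounded f.
Proof. by move=> /smooth_inP[]. Qed.

Lemma sb_bounded_gt0 f : smooth_bounded f ->
  exists2 C : R, 0 < C & forall x, `|f x| <= C.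
Proof.
move=> /sb_bounded[C HC]; exists (C + 1) => [|x].
  by rewrite ltr_wpDl// (le_trans _ (HC 0)).
by rewrite (le_trans (HC x))// lerDl.
Qed.

Lemma sb_derive f : smooth_bounded f -> smooth_bounded (derive1 f).
Proof. by move=> /smooth_inP[]. Qed.

Lemma sb_deriven f n : smooth_bounded f -> smooth_bounded (derive1n n f).
Proof. by move=> sf; elim: n => // n IH; rewrite derive1nS; exact: sb_derive. Qed.

Lemma sb_is_derive f x : smooth_bounded f -> is_derive x 1 f ((derive1 f) x).
Proof.
by move=> sf; apply: DeriveDef; [exact: sb_derivable|rewrite derive1E].
Qed.

Lemma sb_continuous f : smooth_bounded f -> continuous f.
Proof.
move=> sf x; apply: differentiable_continuous.
by apply/derivable1_diffP; exact: sb_derivable.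
Qed.

Lemma sb_measurable f : smooth_bounded f -> measurable_fun setT f.
Proof. by move=> sf; apply: continuous_measurable_fun; exact: sb_continuous. Qed.

Lemma sb_comp_measurable d (T : measurableType d) (D : set T) (h : T -> R) f :
  smooth_bounded f -> measurable_fun D h -> measurable_fun D (fun w => f (h w)).
Proof. by move=> sf mh; apply: measurableT_comp => //; exact: sb_measurable. Qed.

Lemma sb_cst c : smooth_bounded (fun=> c).
Proof.
apply: (@smooth_in_coind _ [set f | exists c, f = fun=> c]); last by exists c.
move=> _ [{}c ->]; split; first by move=> x; exact: derivable_cst.
  by exists `|c|.
by exists 0; apply/funext => x; rewrite derive1_cst.
Qed.

Lemma derive1_lin f g a x : derivable f x 1 -> derivable g x 1 ->
  (derive1 (fun x => a * f x + g x)) x = a * (derive1 f) x + (derive1 g) x.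
Proof.
move=> df dg; rewrite !derive1E.
have := @deriveD _ _ _ (a \*: f) g x 1 (derivableZ df) dg.
by rewrite deriveZ.
Qed.

Lemma sb_lin f g a : smooth_bounded f -> smooth_bounded g ->
  smooth_bounded (fun x => a * f x + g x).
Proof.
move=> sf sg; apply: (@smooth_in_coind _ [set h | exists f g,
  [/\ smooth_bounded f, smooth_bounded g & h = fun x => a * f x + g x]]);
  last by exists f, g.
move=> _ {f g sf sg} [f [g [sf sg ->]]]; split.
- move=> x; apply: (@derivableD _ _ _ (a \*: f) g).
    by apply: derivableZ; exact: sb_derivable.
  exact: sb_derivable.
- have [C HC] := sb_bounded sf; have [D HD] := sb_bounded sg.
  exists (`|a| * C + D) => x; rewrite (le_trans (ler_normD _ _))//.
  by rewrite lerD// normrM ler_wpM2l.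
- exists (derive1 f), (derive1 g); split; [exact: sb_derive|exact: sb_derive|].
  by apply/funext => x; rewrite derive1_lin//; exact: sb_derivable.
Qed.

Lemma sbD f g : smooth_bounded f -> smooth_bounded g ->
  smooth_bounded (fun x => f x + g x).
Proof.
move=> sf sg; have := sb_lin 1 sf sg.
by congr smooth_bounded; apply/funext => x; rewrite mul1r.
Qed.

Lemma sbZ f a : smooth_bounded f -> smooth_bounded (fun x => a * f x).
Proof.
move=> sf; have := sb_lin a sf (sb_cst 0).
by congr smooth_bounded; apply/funext => x; rewrite addr0.
Qed.

Lemma sb_sum (I : Type) (s : seq I) (F : I -> R -> R) :
  (forall i, smooth_bounded (F i)) -> smooth_bounded (fun x => \sum_(i <- s) F i x).
Proof.
move=> sF; elim: s => [|i s IH].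
  by under eq_fun do rewrite big_nil; exact: sb_cst.
by under eq_fun do rewrite big_cons; exact: sbD.
Qed.

Lemma derive1_mul f g x : derivable f x 1 -> derivable g x 1 ->
  (derive1 (fun x => f x * g x)) x = (derive1 f) x * g x + f x * (derive1 g) x.
Proof.
move=> df dg; rewrite !derive1E (@deriveM _ _ f g)//.
by rewrite addrC; congr (_ + _); rewrite [LHS]mulrC.
Qed.

(** The family closed under differentiation consists of the finite sums of products, which replaces
    the binomial Leibniz formula. The conditions on [B] hold for bounded and for decaying functions
    alike. *)
Lemma smooth_in_mul (B : set (R -> R)) f g :
    B (fun=> 0) -> (forall f g, B f -> B g -> B (fun x => f x + g x)) ->
    (forall f g, B f -> unif_bounded g -> B (fun x => f x * g x)) ->
  smooth_in B f -> smooth_bounded g -> smooth_in B (fun x => f x * g x).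
Proof.
move=> B0 BD BM sf sg.
pose S := [set h : R -> R | exists2 s : seq ((R -> R) * (R -> R)),
  (forall p, p \in s -> smooth_in B p.1 /\ smooth_bounded p.2) &
  h = fun x => \sum_(p <- s) p.1 x * p.2 x].
suff /(_ (fun x => f x * g x)) : S `<=` smooth_in B.
  apply; exists [:: (f, g)] => [p|]; first by rewrite inE => /eqP ->.
  by apply/funext => x; rewrite big_seq1.
apply: smooth_in_coind => {f g sf sg} _ [s Hs ->].
suff [ds Bs Ss] : [/\ forall x, derivable (fun x => \sum_(p <- s) p.1 x * p.2 x) x 1,
    B (fun x => \sum_(p <- s) p.1 x * p.2 x) &
    S (derive1 (fun x => \sum_(p <- s) p.1 x * p.2 x))] by [].
elim: s Hs => [|[f g] s IH] Hs.
  under eq_fun do rewrite big_nil.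
  split; [by move=> x; exact: derivable_cst|by []|].
  exists [::] => //; apply/funext => x.
  by rewrite big_nil derive1_cst.
have [sf sg] : smooth_in B f /\ smooth_bounded g by apply: (Hs (f, g)); exact: mem_head.
have [|ds Bs [s' Hs' Es']] := IH.
  by move=> p ps; apply: Hs; rewrite inE ps orbT.
have [df Bf sf'] := smooth_inP sf.
have [dg bg sg'] := smooth_inP sg.
under eq_fun do rewrite big_cons/=.
have dfg x : derivable (fun x => f x * g x) x 1 by exact: derivableM.
split; first by move=> x; exact: derivableD.
  by apply: BD => //; exact: BM.
exists [:: (derive1 f, g), (f, derive1 g) & s'].
  by move=> p; rewrite !inE => /or3P[/eqP->//|/eqP->//|/Hs'].
apply/funext => x; rewrite !big_cons/=.
under [X in derive1 X]eq_fun do rewrite -[f _ * _]mul1r.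
rewrite (@derive1_lin (fun x => f x * g x))//.
by rewrite Es' mul1r derive1_mul// !addrA.
Qed.

Lemma sbM f g : smooth_bounded f -> smooth_bounded g ->
  smooth_bounded (fun x => f x * g x).
Proof.
move=> sf sg; apply: smooth_in_mul => //.
- by exists 0 => x; rewrite normr0.
- move=> {sf sg} f0 g0 [C HC] [D HD]; exists (C + D) => x.
  by rewrite (le_trans (ler_normD _ _))// lerD.
- move=> {sf sg} f0 g0 [C HC] [D HD]; exists (C * D) => x.
  by rewrite normrM ler_pM.
Qed.

Lemma schwartzM f g : schwartz f -> smooth_bounded g ->
  schwartz (fun x => f x * g x).
Proof.
move=> /schwartzP sf sg; apply/schwartzP; apply: smooth_in_mul => //.
- by move=> k; exists 0 => x; rewrite normr0 mulr0.
- move=> {sf sg} f0 g0 Bf Bg k; have [C HC] := Bf k; have [D HD] := Bg k.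
  exists (C + D) => x; rewrite (le_trans _ (lerD (HC x) (HD x)))//.
  by rewrite -mulrDr ler_wpM2l ?exprn_ge0// ler_normD.
- move=> {sf sg} f0 g0 Bf [D HD] k; have [C HC] := Bf k; exists (C * D) => x.
  by rewrite normrM mulrA ler_pM// mulr_ge0// exprn_ge0.
Qed.

Lemma is_derive_affine f a b x : derivable f (a * x + b) 1 ->
  is_derive x 1 (fun x => f (a * x + b)) (a * derive1 f (a * x + b)).
Proof.
move=> df; have df' : is_derive (a * x + b) 1 f (derive1 f (a * x + b)).
  by rewrite derive1E; exact: DeriveDef.
have dl : is_derive x 1 (fun x => a * x + b) a.
  apply: DeriveDef; first by apply: derivableD => //; exact: derivableM.
  by rewrite -derive1E derive1_lin// derive1_id derive1_cst mulr1 addr0.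
by rewrite mulrC; exact: (@is_derive1_comp _ f (fun x => a * x + b)).
Qed.

Lemma derive1_affine f a b x : derivable f (a * x + b) 1 ->
  derive1 (fun x => f (a * x + b)) x = a * derive1 f (a * x + b).
Proof. by move=> /is_derive_affine df; rewrite derive1E derive_val. Qed.

Lemma smooth_in_affine (B : set (R -> R)) f a b :
    (forall c f, B f -> B (fun x => c * f (a * x + b))) ->
  smooth_in B f -> smooth_in B (fun x => f (a * x + b)).
Proof.
(* Each derivative releases a factor [a], hence the constant [c] in the family. *)
move=> HB sf; apply: (@smooth_in_coind _ [set h | exists c, exists2 f, smooth_in B f &
  h = fun x => c * f (a * x + b)]); last first.
  by exists 1, f => //; apply/funext => x; rewrite mul1r.
move=> _ [c [{}f {}sf ->]]; have [df Bf sf'] := smooth_inP sf.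
have daf x : derivable (fun x : R => f (a * x + b)) x 1.
  by have [] := is_derive_affine (df (a * x + b)).
split.
- by move=> x; apply: derivableM.
- exact: HB.
- exists (c * a), (derive1 f) => //.
  apply/funext => x; under eq_fun do rewrite -[c * _]addr0.
  rewrite (@derive1_lin (fun x => f (a * x + b)) (cst 0)) ?derive1_cst//.
  by rewrite derive1_affine ?addr0 ?mulrA.
Qed.

Lemma sb_affine f a b : smooth_bounded f ->
  smooth_bounded (fun x => f (a * x + b)).
Proof.
apply: smooth_in_affine => c {}f [C HC]; exists (`|c| * C) => x.
by rewrite normrM ler_wpM2l.
Qed.

Lemma schwartz_affine f a : a != 0 -> schwartz f -> schwartz (fun x => f (a * x + 0)).
Proof.
move=> a0 /schwartzP sf; apply/schwartzP; apply: smooth_in_affine sf => c {}f Bf k.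
have [C HC] := Bf k; exists (`|c| / `|a| ^+ k * C) => x.
have := HC (a * x + 0); rewrite {1}addr0 normrM exprMn => H.
rewrite normrM mulrCA -mulrA ler_wpM2l// ler_pdivlMl ?mulrA// exprn_gt0//.
by rewrite normr_gt0.
Qed.

Lemma sb_shift f b : smooth_bounded f -> smooth_bounded (fun x => f (x + b)).
Proof.
by move=> /(sb_affine 1 b); congr smooth_bounded; apply/funext => x; rewrite mul1r.
Qed.

Lemma derive1_shift f b x : derivable f (x + b) 1 ->
  (derive1 (fun x => f (x + b))) x = (derive1 f) (x + b).
Proof.
move=> df; under eq_fun do rewrite -[X in f (X + _)]mul1r.
by rewrite derive1_affine !mul1r.
Qed.

End smooth_bounded.

(** * Averaging operators *)

Section averaging.
Context {R : realType} d {T : measurableType d} (mu : {measure set T -> \bar R}).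
Variable D : set T.
Hypothesis mD : measurable D.
Implicit Types (u v k g : T -> R) (f : R -> R).

Lemma integrable_bounded_mul g k C : measurable_fun D g ->
  (forall w, D w -> `|g w| <= C) -> mu.-integrable D (EFin \o k) ->
  mu.-integrable D (EFin \o (fun w => g w * k w)).
Proof.
move=> mg gC ik; have [mk _] := integrableP _ _ _ ik.
apply: (@le_integrable _ _ _ mu D mD _ (fun w => C%:E * (EFin \o k) w)%E).
- apply/measurable_EFinP; apply: measurable_funM => //.
  exact/measurable_EFinP.
- move=> w Dw; rewrite /= lee_fin !normrM ler_wpM2r//.
  by rewrite (le_trans (gC w Dw))// ler_norm.
- exact: integrableZl.
Qed.

(** One shape for three uses: [u = 1] with a gamma weight, [u = 1] with a probability and weight 1
    (translation by a random variable), and [u t = t] on [0, 1] for Hadamard's lemma. *)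
Definition avg u v k f (x : R) : R :=
  \int[mu]_(w in D) (f (u w * x + v w) * k w).

Variables u v k : T -> R.
Hypotheses (mfu : measurable_fun D u) (mv : measurable_fun D v).
Hypothesis u1 : forall w, D w -> `|u w| <= 1.
Hypothesis ik : mu.-integrable D (EFin \o k).

Lemma integrable_avg f x : smooth_bounded f ->
  mu.-integrable D (EFin \o (fun w => f (u w * x + v w) * k w)).
Proof.
move=> sf; have [C HC] := sb_bounded sf.
apply: (integrable_bounded_mul (C := C)) => //.
apply: sb_comp_measurable => //.
by apply: measurable_funD => //; exact: measurable_funM.
Qed.

(** As [u] is bounded by 1, a multiple of |k| dominates the derivative under the integral sign. The
    result is again an average, with weight [u * k], which is what the coinduction in [sb_avg]
    needs. *)
Lemma is_derive_avg f (x : R) : smooth_bounded f ->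
  is_derive x (1 : R) (avg u v k f) (avg u v (fun w => u w * k w) (derive1 f) x).
Proof.
move=> sf; have [C C0 HC] := sb_bounded_gt0 (sb_derive sf).
pose h (y : R) (w : T) : R := f (u w * y + v w) * k w.
have dh (y : R) w : D w -> is_derive y (1 : R) (h ^~ w) (u w * derive1 f (u w * y + v w) * k w).
  move=> Dw; have [dfw efw] := @is_derive_affine R f (u w) (v w) y (sb_derivable sf).
  apply: DeriveDef; first exact: derivableM.
  have -> : h ^~ w = fun y => k w * f (u w * y + v w) + cst 0 y.
    by apply/funext => z; rewrite /h mulrC addr0.
  rewrite -derive1E.
  rewrite (@derive1_lin _ (fun y => f (u w * y + v w)) (cst 0))//.
  by rewrite derive1_cst addr0 derive1E efw mulrC.
have xI : [set` `]x - 1, x + 1[] x by rewrite /= in_itv/= ltrBlDr ltrDl ltr01.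
have G0 w : 0 <= C * `|k w| by rewrite mulr_ge0// ltW.
have iG : mu.-integrable D (EFin \o (fun w => C * `|k w|)).
  apply: (@integrable_bounded_mul (cst C) (fun w => `|k w|) C) => //.
  - by move=> w _; rewrite gtr0_norm.
  - exact: integrable_norm.
have intf y : [set` `]x - 1, x + 1[] y -> mu.-integrable D (EFin \o h y).
  by move=> _; exact: integrable_avg.
have derf (y : R) w : [set` `]x - 1, x + 1[] y -> D w -> derivable (h ^~ w) y (1 : R).
  by move=> _ Dw; have [] := dh y w Dw.
have Gub y w : [set` `]x - 1, x + 1[] y -> D w -> `|partial1of2 h y w| <= C * `|k w|.
  move=> _ Dw; rewrite partial1of2E; have [_ ->] := dh y w Dw.
  rewrite !normrM ler_wpM2r// -[leRHS]mul1r ler_pM//; exact: u1.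
apply: DeriveDef.
  exact: (derivable_under_integral mD xI intf derf G0 iG Gub).
rewrite -derive1E (differentiation_under_integral mD xI intf derf G0 iG Gub).
apply: eq_Rintegral => w /set_mem Dw.
rewrite partial1of2E; have [_ ->] := dh x w Dw; ring.
Qed.

End averaging.

Section averaging_smooth.
Context {R : realType} d {T : measurableType d} (mu : {measure set T -> \bar R}).
Variable D : set T.
Hypothesis mD : measurable D.
Implicit Types (u v k : T -> R) (f : R -> R).

Lemma sb_avg u v k f : measurable_fun D u -> measurable_fun D v ->
  (forall w, D w -> `|u w| <= 1) -> mu.-integrable D (EFin \o k) ->
  smooth_bounded f -> smooth_bounded (avg mu D u v k f).
Proof.
move=> mfu mv u1 ik sf.
apply: (@smooth_in_coind _ _ [set h | exists2 k, mu.-integrable D (EFin \o k) &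
  exists2 f, smooth_bounded f & h = avg mu D u v k f]); last by exists k => //; exists f.
move=> _ {k f ik sf} [k ik [f sf ->]]; split.
- by move=> x; have [] := is_derive_avg mD mfu mv u1 ik x sf.
- have [C C0 HC] := sb_bounded_gt0 sf; exists (\int[mu]_(w in D) (C * `|k w|)) => x.
  have iC : mu.-integrable D (EFin \o (fun w => C * `|k w|)).
    apply: (@integrable_bounded_mul _ _ _ _ _ _ (cst C) (fun w => `|k w|) C) => //.
    - by move=> w _; rewrite gtr0_norm.
    - exact: integrable_norm.
  have ia := integrable_avg mD mfu mv ik x sf.
  rewrite (le_trans (le_normr_Rintegral mD ia))// le_Rintegral//.
    exact: integrable_norm.
  by move=> w _; rewrite normrM ler_wpM2r.
- exists (fun w => u w * k w); first exact: (integrable_bounded_mul mD mfu u1 ik).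
  exists (derive1 f); first exact: sb_derive.
  apply/funext => x; rewrite derive1E.
  by have [_ ->] := is_derive_avg mD mfu mv u1 ik x sf.
Qed.

End averaging_smooth.

Section Rintegral_sum.
Context {R : realType} d {T : measurableType d} (mu : {measure set T -> \bar R}).
Variable D : set T.
Hypothesis mD : measurable D.

Lemma Rintegral_sum (I : Type) (s : seq I) (f : I -> T -> R) :
    (forall i, mu.-integrable D (EFin \o f i)) ->
  \int[mu]_(x in D) (\sum_(i <- s) f i x) = \sum_(i <- s) \int[mu]_(x in D) f i x.
Proof.
move=> intf; elim: s => [|i s IH].
  under eq_Rintegral do rewrite big_nil.
  by rewrite big_nil Rintegral_cst// mul0r.
under eq_Rintegral do rewrite big_cons.
rewrite RintegralD//; first by rewrite big_cons IH.
have := @integrable_sum _ _ _ mu D mD _ s xpredT (fun i x => (f i x)%:E) (fun i _ => intf i).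
by apply: eq_integrable => // w _; rewrite /= sumEFin.
Qed.

End Rintegral_sum.

(** * Operators with constant coefficients and commutators with multiplication by x *)

Section operators.
Context {R : realType}.
Implicit Types (f g eta chi psi : R -> R) (a b c x : R).

(** Constant coefficients are encoded by linearity and commutation with D; this already gives
    commutation with every [subDerive c]. *)
Record sb_operator (V : (R -> R) -> R -> R) : Prop := SbOperator {
  op_sb : forall f, smooth_bounded f -> smooth_bounded (V f) ;
  op_lin : forall a f g, smooth_bounded f -> smooth_bounded g ->
    V (fun x => a * f x + g x) = fun x => a * V f x + V g x ;
  op_derive : forall f, smooth_bounded f -> V (derive1 f) = derive1 (V f) }.

Lemma sb_operator_id : sb_operator id.
Proof. by split. Qed.

Lemma sb_operator_comp V W : sb_operator V -> sb_operator W ->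
  sb_operator (V \o W).
Proof.
move=> oV oW; split=> [f sf|a f g sf sg|f sf] /=.
- by apply: (op_sb oV); exact: (op_sb oW).
- by rewrite (op_lin oW)// (op_lin oV)//; exact: (op_sb oW).
- by rewrite (op_derive oW)// (op_derive oV)//; exact: (op_sb oW).
Qed.

Lemma op0 V : sb_operator V -> V (fun=> 0) = fun=> 0.
Proof.
move=> oV.
have := op_lin oV (- 1) (sb_cst 0) (sb_cst 0).
rewrite (_ : (fun x : R => - 1 * 0 + 0) = fun=> 0); last first.
  by apply/funext => x; rewrite mulr0 addr0.
by move=> ->; apply/funext => x; rewrite mulN1r addNr.
Qed.

Lemma opZ V a f : sb_operator V -> smooth_bounded f ->
  V (fun x => a * f x) = fun x => a * V f x.
Proof.
move=> oV sf.
have -> : (fun x => a * f x) = (fun x : R => a * f x + (fun=> 0) x).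
  by apply/funext => x; rewrite addr0.
rewrite (op_lin oV)//; last exact: sb_cst.
by rewrite op0//; apply/funext => x; rewrite addr0.
Qed.

Lemma op_sum V (I : Type) (s : seq I) (a : I -> R) (F : I -> R -> R) :
  sb_operator V -> (forall i, smooth_bounded (F i)) ->
  V (fun x => \sum_(i <- s) a i * F i x) = fun x => \sum_(i <- s) a i * V (F i) x.
Proof.
move=> oV sF; elim: s => [|i s IH].
  under eq_fun do rewrite big_nil.
  by rewrite op0//; apply/funext => x; rewrite big_nil.
under eq_fun do rewrite big_cons.
rewrite (op_lin oV)//; last by apply: sb_sum => j; exact: sbZ.
by rewrite IH; apply/funext => x; rewrite big_cons.
Qed.

Lemma sb_operator_shift b : sb_operator (fun f x => f (x + b)).
Proof.
split=> [f sf|//|f sf]; first exact: sb_shift.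
by apply/funext => x; rewrite derive1_shift//; exact: sb_derivable.
Qed.

Definition subDerive c f : R -> R := fun x => f x - c * derive1 f x.

Lemma subDeriveE c f : subDerive c f = fun x => - c * derive1 f x + f x.
Proof. by apply/funext => x; rewrite /subDerive mulNr addrC. Qed.

Lemma sb_operator_subDerive c : sb_operator (subDerive c).
Proof.
split=> [f sf|a f g sf sg|f sf].
- by rewrite subDeriveE; apply: sb_lin => //; exact: sb_derive.
- apply/funext => x; rewrite /subDerive derive1_lin; [ring|exact: sb_derivable..].
- apply/funext => x; rewrite subDeriveE [in RHS]subDeriveE derive1_lin//.
    by apply: sb_derivable; exact: sb_derive.
  exact: sb_derivable.
Qed.
Let oL := sb_operator_subDerive.

Definition op_comm (V W : (R -> R) -> R -> R) :=
  forall f, smooth_bounded f -> V (W f) = W (V f).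

Lemma op_comm_subDerive V c : sb_operator V -> op_comm V (subDerive c).
Proof.
move=> oV f sf; rewrite !subDeriveE (op_lin oV) ?(op_derive oV)//.
exact: sb_derive.
Qed.

Lemma sb_operator_iter V n : sb_operator V -> sb_operator (iter n V).
Proof.
move=> oV; elim: n => [|n IH]; first exact: sb_operator_id.
by have := sb_operator_comp oV IH.
Qed.

Lemma op_comm_iter V W n : sb_operator V -> sb_operator W ->
  op_comm V W -> op_comm V (iter n W).
Proof.
move=> oV oW VW f sf; elim: n => //= n <-; rewrite VW//.
exact: (op_sb (sb_operator_iter n oW)).
Qed.

(* [twisted W V b] is the commutator identity [W (x chi) = x (W chi) - b (V chi)].
   As [x chi] need not be bounded, it is stated on bounded functions [eta] which
   split as [x chi + psi]. *)
Definition decomp eta chi psi := [/\ smooth_bounded eta, smooth_bounded chi,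
  smooth_bounded psi & forall x, eta x = x * chi x + psi x].

Definition twisted (W V : (R -> R) -> R -> R) b := forall eta chi psi,
  decomp eta chi psi -> forall x, W eta x = x * W chi x - b * V chi x + W psi x.

Lemma twisted_subDerive c : twisted (subDerive c) id c.
Proof.
move=> eta chi psi [se sc sp E] x.
have -> : eta = fun x => (fun x => x) x * chi x + psi x by apply/funext => y; rewrite E.
have dx : derivable (fun x : R => x * chi x) x 1.
  by apply: derivableM => //; exact: sb_derivable.
have dp : derivable psi x 1 by exact: sb_derivable.
rewrite /subDerive; under [X in derive1 X]eq_fun do rewrite -[_ * chi _]mul1r.
rewrite (@derive1_lin _ (fun x => x * chi x))// derive1_mul//; last exact: sb_derivable.
rewrite derive1_id; ring.
Qed.

(** This is the commutator rule [p(D), x] = p'(D) for p(t) = (1 - c t)^(n+1). *)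
Lemma twisted_iter_subDerive c n :
  twisted (iter n.+1 (subDerive c)) (iter n (subDerive c)) (n.+1%:R * c).
Proof.
elim: n => [|n IH] eta chi psi [se sc sp E] x.
  by rewrite mul1r; exact: twisted_subDerive.
have oI m := sb_operator_iter m (oL c).
(* The term - c chi produced by one factor is moved into the remainder, so that the induction
   hypothesis applies to the result. *)
have E' : decomp (subDerive c eta) (subDerive c chi)
    (fun x => - c * chi x + subDerive c psi x).
  have sp' := op_sb (oL c) sp.
  split; [exact: op_sb|exact: op_sb|exact: sb_lin|].
  by move=> y; rewrite (@twisted_subDerive c eta chi psi)//=; ring.
rewrite 3![iter n.+2 _ _]iterSr (IH _ _ _ E') -iterSr (op_lin (oI n.+1))//; last first.
  exact: op_sb.
rewrite -[n.+2%:R]natr1 -!iterSr.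
move: (iter n.+2 _ chi x) (iter n.+1 _ chi x) (iter n.+2 _ psi x) => u v w; ring.
Qed.

Section product.
Variables (I : eqType) (c : I -> R).

Definition subDerives (s : seq I) f := foldr (fun j => subDerive (c j)) f s.

Lemma sb_operator_subDerives s : sb_operator (subDerives s).
Proof.
elim: s => [|j s IH]; first exact: sb_operator_id.
exact: (sb_operator_comp (oL _) IH).
Qed.

Lemma op_comm_subDerives V s : sb_operator V -> op_comm V (subDerives s).
Proof.
move=> oV f sf; elim: s => //= j s <-.
by rewrite op_comm_subDerive//; exact: (op_sb (sb_operator_subDerives s)).
Qed.

Variable V : I -> (R -> R) -> R -> R.
Hypothesis oV : forall i, sb_operator (V i).

Definition op_prod (s : seq I) f := foldr V f s.

Lemma sb_operator_prod s : sb_operator (op_prod s).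
Proof.
elim: s => [|j s IH]; first exact: sb_operator_id.
exact: (sb_operator_comp (oV _) IH).
Qed.

Lemma op_comm_prod W s : sb_operator W -> (forall i, op_comm W (V i)) ->
  op_comm W (op_prod s).
Proof.
move=> oW WV f sf; elim: s => //= j s <-.
by rewrite WV//; exact: (op_sb (sb_operator_prod s)).
Qed.

Variable a : I -> R.
Hypothesis tV : forall i, twisted (subDerive (c i) \o V i) (V i) (a i * c i).

(** Commutation with x obeys a Leibniz rule over the factors: the k-th one contributes a_k c_k with
    its own 1 - c_k D removed. *)
Lemma twisted_prod s : uniq s -> forall eta chi psi, decomp eta chi psi ->
  forall x, subDerives s (op_prod s eta) x = x * subDerives s (op_prod s chi) x
    - \sum_(k <- s) a k * c k * subDerives (rem k s) (op_prod s chi) x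
    + subDerives s (op_prod s psi) x.
Proof.
have oS := sb_operator_subDerives; have oP := sb_operator_prod.
elim: s => [_|j s IH /andP[js us]] eta chi psi E.
  by move=> x; rewrite big_nil subr0; have [] := E.
have [se sc sp _] := E.
set W := subDerives s \o op_prod s.
have oW : sb_operator W by exact: sb_operator_comp.
(* Moving [V j] past the factors of [s] puts the two operators of index [j] side by side, where [tV]
   applies. *)
have WE f : smooth_bounded f ->
    subDerives (j :: s) (op_prod (j :: s) f) = (subDerive (c j) \o V j) (W f).
  move=> sf; rewrite /W /= (op_comm_subDerives _ (oV j))//.
  exact: (op_sb (oP s)).
(* The corrections collected so far become part of the remainder, on which the operators of index
   [j] act linearly. *)
pose psi' x := - 1 * (\sum_(k <- s) a k * c k * subDerives (rem k s) (op_prod s chi) x)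
  + W psi x.
have sk k : smooth_bounded (subDerives (rem k s) (op_prod s chi)).
  by apply: (op_sb (oS _)); exact: (op_sb (oP s)).
have ssum : smooth_bounded
    (fun x => \sum_(k <- s) a k * c k * subDerives (rem k s) (op_prod s chi) x).
  by apply: sb_sum => k; exact: sbZ.
have E' : decomp (W eta) (W chi) psi'.
  split; [exact: op_sb|exact: op_sb| |].
    by apply: sb_lin => //; exact: op_sb.
  by move=> x; rewrite /W/= (IH us _ _ _ E) /psi' mulN1r addrA.
move=> x; rewrite !WE// (tV j E').
rewrite (op_lin (sb_operator_comp (oL (c j)) (oV j)))//; last exact: op_sb.
rewrite (op_sum _ _ (sb_operator_comp (oL (c j)) (oV j)))//.
rewrite big_cons /= eqxx mulN1r.
have -> : V j (W chi) = subDerives s (op_prod (j :: s) chi).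
  by rewrite /W /= (op_comm_subDerives _ (oV j))//; exact: (op_sb (oP s)).
rewrite [X in - (_ + X)](_ : _ = \sum_(k <- s) a k * c k *
   subDerive (c j) (V j (subDerives (rem k s) (op_prod s chi))) x); first by ring.
rewrite !big_seq; apply: eq_bigr => k ks.
(* [rem k (j :: s)] keeps [j] because uniqueness excludes [j = k]; the factor [subDerive (c j)] thus
   stays in front. *)
rewrite (_ : (j == k) = false); last by apply/negbTE; apply: contraNneq js => ->.
by rewrite /= (op_comm_subDerives _ (oV j))//; exact: (op_sb (oP s)).
Qed.

End product.

End operators.

(** * Gamma weights *)

Section improper_FTC.
Context {R : realType}.
Notation leb := (@lebesgue_measure R).
Notation D0 := (`]0, +oo[%classic : set R).

(** The end point 0 is left out and approached by a limit, since [f] may be unbounded there, as it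
    is for a gamma weight of parameter below 1. *)
Lemma integral_derive_itv0y (H f : R -> R) :
    (forall x : R, 0 < x -> is_derive x (1 : R) H (f x)) ->
    (forall x : R, 0 < x -> {for x, continuous f}) ->
    leb.-integrable D0 (EFin \o f) ->
    H x @[x --> 0^'+] --> (0 : R) -> H x @[x --> +oo] --> (0 : R) ->
  (\int[leb]_(x in D0) (f x)%:E = 0)%E.
Proof.
move=> dH cf intf H0 Hy.
(* The compact intervals [1/(n+2), n+1] exhaust the half-line; n + 2 makes them nondegenerate
   already for n = 0. *)
pose a n : R := n.+2%:R^-1; pose b n : R := n.+1%:R.
have a0 n : 0 < a n by rewrite invr_gt0 ltr0n.
have ab n : a n < b n.
  by rewrite (@lt_le_trans _ _ 1)// ?ler1n// invf_lt1 ?ltr0n// ltr1n.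
have cvga : a n @[n --> \oo] --> 0.
  by have := @cvg_harmonic R; rewrite -(cvg_shiftS (@harmonic R)).
have cvgb : b n @[n --> \oo] --> +oo.
  by have := @cvgr_idn R; rewrite -(cvg_shiftS (fun n => n%:R : R)).
have HabE : H (b n) - H (a n) @[n --> \oo] --> 0.
  rewrite -[X in _ --> X]subr0; apply: cvgB.
    by move/cvg_pinftyP : Hy; exact.
  by move/cvg_at_rightP : H0; exact.
pose fn n := (EFin \o f) \_ `[a n, b n].
have subD n : `[a n, b n] `<=` D0.
  by move=> x /=; rewrite !in_itv/= andbT => /andP[/(lt_le_trans (a0 n))].
have mf : measurable_fun D0 (EFin \o f) by have /integrableP[] := intf.
have Hint n : (\int[leb]_(x in D0) fn n x = (H (b n) - H (a n))%:E)%E.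
  rewrite -integral_mkcondr setIidr//.
  rewrite (@continuous_FTC2 _ f H)//.
  - apply: continuous_in_subspaceT => x; rewrite inE/= in_itv/= => /andP[+ _].
    by move=> /(lt_le_trans (a0 n)); exact: cf.
  - have cH (x : R) : 0 < x -> H z @[z --> x] --> H x.
      by move=> x0; apply: differentiable_continuous; apply/derivable1_diffP;
        have [] := dH x x0.
    split.
    + move=> x; rewrite in_itv/= => /andP[/(lt_trans (a0 n)) x0 _].
      by have [] := dH x x0.
    + by apply: cvg_at_right_filter; exact: cH.
    + by apply: cvg_at_left_filter; apply: cH; rewrite (lt_trans (a0 n)).
  - move=> x; rewrite in_itv/= => /andP[/(lt_trans (a0 n)) x0 _].
    by rewrite derive1E; have [_ ->] := dH x x0.
have lim1 : (\int[leb]_(x in D0) fn n x @[n --> \oo] --> \int[leb]_(x in D0) (f x)%:E)%E.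
  have [||||||_ _ //] := @dominated_convergence _ _ _ leb D0 _ fn (EFin \o f) (abse \o (EFin \o f)).
  - by [].
  - move=> n; apply/measurable_restrict => //.
    by rewrite setIidr//; exact: measurable_funS mf.
  - by [].
  - apply: aeW => x; rewrite /= in_itv/= andbT => x0.
    apply: cvg_near_cst.
    near=> n; rewrite /fn patchE ifT// inE/= in_itv/=; apply/andP; split.
      by apply: ltW; near: n; apply: cvgr_lt cvga _ x0.
    by near: n; move/cvgryPge : cvgb; exact.
  - exact: integrable_abse.
  - apply: aeW => x n Dx; rewrite /fn patchE; case: ifP => //=.
    by rewrite normr0 lee_fin.
have lim2 : (\int[leb]_(x in D0) fn n x @[n --> \oo] --> 0)%E.
  under eq_fun do rewrite Hint.
  by apply: cvg_EFin => //; exact: nearW.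
exact: (cvg_unique _ lim1 lim2).
Unshelve. all: by end_near. Qed.

End improper_FTC.

(** * Integration by parts against a gamma weight *)

Section gamma_weight.
Context {R : realType}.
Notation leb := (@lebesgue_measure R).
Notation D0 := (`]0, +oo[%classic : set R).
Variable r : R.
Hypothesis r0 : 0 < r.
Implicit Types (s p x : R).

Definition gamma_weight s x := x `^ (s - 1) * expR (- (r * x)).

Lemma gamma_weight_ge0 s x : 0 <= gamma_weight s x.
Proof. by rewrite mulr_ge0 ?powR_ge0 ?expR_ge0. Qed.

Lemma gamma_weightS s x : 0 < x -> gamma_weight (s + 1) x = x * gamma_weight s x.
Proof.
move=> x0; rewrite /gamma_weight addrK mulrA; congr (_ * _).
rewrite -{2}(powRr1 (ltW x0)) -powRD; last by rewrite (gt_eqF x0) implybT.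
by rewrite addrC subrK.
Qed.

Lemma measurable_gamma_weight s : measurable_fun D0 (gamma_weight s).
Proof.
apply: measurable_funTS; apply: measurable_funM => //.
apply: measurableT_comp => //; apply: measurable_funN.
exact: measurable_funM.
Qed.

Lemma integrable_expRN_itv0y (q : R) : 0 < q ->
  leb.-integrable D0 (EFin \o (fun x => expR (- (q * x)))).
Proof.
move=> q0.
have i0 : leb.-integrable D0 (EFin \o exponential_pdf q).
  exact: integrableS (integrable_exponential_pdf q0).
have mD : measurable (D0 : set (measurableTypeR R)) by [].
have := integrableZl mD q^-1 i0.
apply: eq_integrable => // x; rewrite inE/= in_itv/= andbT => x0.
by rewrite exponential_pdfE ?ltW// -EFinM mulKf ?gt_eqF// mulNr.
Qed.

Lemma gamma_weight_le s : 1 <= s -> exists2 C : R, 0 < C &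
  forall x, 0 < x -> gamma_weight s x <= C * expR (- (r / 2 * x)).
Proof.
(* With q s = r / 2, raising x <= e^(qx) / q to the power s - 1 leaves the exponent q (s - 1) - r =
   - r / 2 - q. *)
move=> s1; pose q := r / (2 * s).
have s0 : 0 < s by rewrite (lt_le_trans _ s1).
have q0 : 0 < q by rewrite divr_gt0// mulr_gt0.
exists (q^-1 `^ (s - 1)) => [|x x0]; first by rewrite powR_gt0// invr_gt0.
have xle : x <= q^-1 * expR (q * x).
  rewrite -ler_pdivrMl ?invr_gt0// invrK (le_trans _ (expR_ge1Dx _))//.
  by rewrite lerDr.
have : x `^ (s - 1) <= (q^-1 * expR (q * x)) `^ (s - 1).
  rewrite ge0_ler_powR ?nnegrE ?subr_ge0// ?(ltW x0)//.
  by rewrite mulr_ge0 ?invr_ge0 ?expR_ge0 ?(ltW q0).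
rewrite powRM ?invr_ge0 ?expR_ge0 ?(ltW q0)// -expRM => le1.
apply: (le_trans (ler_wpM2r (expR_ge0 _) le1)).
rewrite -[leLHS]mulrA -expRD ler_wpM2l ?powR_ge0// ler_expR.
have -> : q * x * (s - 1) - r * x = - (r / 2 * x) - q * x.
  by rewrite /q; field; rewrite gt_eqF.
by rewrite gerBl mulr_ge0// ltW.
Qed.

Lemma integrable_gamma_weight s : 1 <= s ->
  leb.-integrable D0 (EFin \o gamma_weight s).
Proof.
move=> s1; have [C C0 HC] := gamma_weight_le s1.
apply: (@le_integrable _ _ _ leb D0 _ _
    (fun x => C%:E * (EFin \o (fun x => expR (- (r / 2 * x)))) x)%E) => //.
- by apply/measurable_EFinP; exact: measurable_gamma_weight.
- move=> x; rewrite /= in_itv/= andbT => x0; rewrite lee_fin.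
  rewrite !ger0_norm ?gamma_weight_ge0//; first exact: HC.
  by rewrite mulr_ge0 ?expR_ge0// ltW.
- by apply: integrableZl => //; apply: integrable_expRN_itv0y; exact: divr_gt0.
Qed.

Lemma is_derive_gamma_weight s x : 0 < x -> is_derive x (1 : R) (gamma_weight (s + 1))
  (s * gamma_weight s x - r * gamma_weight (s + 1) x).
Proof.
move=> x0; rewrite /gamma_weight addrK.
have d1 := is_derive1_powR s x0.
have d2 : is_derive x (1 : R) (fun x => expR (- (r * x))) (- r * expR (- (r * x))).
  have de : derivable (@expR R) (- r * x + 0) 1 by exact: ex_derive.
  have -> : (fun x => expR (- (r * x))) = fun x => expR (- r * x + 0).
    by apply/funext => y; rewrite addr0 mulNr.
  apply: (is_derive_eq (is_derive_affine de)).
  by rewrite derive1E derive_val; congr (_ * expR _); ring.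
apply: (is_derive_eq (is_deriveM d1 d2)).
by rewrite /GRing.scale /=; ring.
Qed.

Lemma gamma_weight_cvg_y s : 0 < s -> gamma_weight (s + 1) x @[x --> +oo] --> (0 : R).
Proof.
move=> s0; have s1 : 1 <= s + 1 by rewrite lerDr ltW.
have [C C0 HC] := gamma_weight_le s1.
apply: (@squeeze_cvgr _ _ _ _ (fun=> 0) (fun x => C * expR (- (r / 2 * x)))).
- near=> x; rewrite gamma_weight_ge0/= HC//.
- exact: cvg_cst.
- rewrite -[X in _ --> X](mulr0 C); apply: cvgM; first exact: cvg_cst.
  apply: (@cvg_comp _ _ _ (fun x => r / 2 * x) (fun x => expR (- x)) _ (pinfty_nbhs R)).
    by apply: gt0_cvgMry => //; exact: divr_gt0.
  exact: cvgr_expR.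
Unshelve. all: by end_near. Qed.

Lemma gamma_weight_cvg0 s : 0 < s -> gamma_weight (s + 1) x @[x --> 0^'+] --> (0 : R).
Proof.
move=> s0; apply: (@squeeze_cvgr _ _ _ _ (fun=> 0) (fun x => x `^ s)).
- near=> x; rewrite gamma_weight_ge0/= /gamma_weight addrK.
  rewrite -[leRHS]mulr1 ler_wpM2l ?powR_ge0// -expR0 ler_expR oppr_le0.
  by rewrite mulr_ge0 ?ltW.
- exact: cvg_cst.
- exact: powR_cvg0.
Unshelve. all: by end_near. Qed.

(** The product of g with the weight of parameter s + 1 vanishes at both ends, so its derivative
    integrates to 0. For s < 1 the weight of parameter s is singular at 0; its integrability is
    therefore assumed here and later obtained from the law. *)
Lemma gamma_weight_by_parts s (g : R -> R) : 0 < s ->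
    leb.-integrable D0 (EFin \o gamma_weight s) -> smooth_bounded g ->
  \int[leb]_(x in D0) ((r * g x - derive1 g x) * gamma_weight (s + 1) x) =
  s * \int[leb]_(x in D0) (g x * gamma_weight s x).
Proof.
move=> s0 iw sg; have sg' := sb_derive sg.
have mD : measurable (D0 : set (measurableTypeR R)) by [].
have iw1 : leb.-integrable D0 (EFin \o gamma_weight (s + 1)).
  by apply: integrable_gamma_weight; rewrite lerDr ltW.
have int_mul h t : smooth_bounded h -> leb.-integrable D0 (EFin \o gamma_weight t) ->
    leb.-integrable D0 (EFin \o (fun x => h x * gamma_weight t x)).
  move=> sh; have [C HC] := sb_bounded sh.
  apply: (@integrable_bounded_mul _ _ _ leb D0 _ h _ C) => //.
  by apply: measurable_funTS; exact: sb_measurable.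
have i0 := int_mul _ _ sg iw; have i1 := int_mul _ _ sg iw1.
have i1' := int_mul _ _ sg' iw1.
have i2 : leb.-integrable D0 (EFin \o (fun x => (r * g x - derive1 g x) * gamma_weight (s + 1) x)).
  apply: int_mul => //; have := sb_lin (- 1) sg' (sbZ r sg).
  by congr smooth_bounded; apply/funext => x; rewrite mulN1r addrC.
have i3 : leb.-integrable D0 (EFin \o (fun x => s * (g x * gamma_weight s x))).
  by have := integrableZl mD s i0.
pose H x := g x * gamma_weight (s + 1) x.
have dH x : 0 < x -> is_derive x (1 : R) H
    (s * (g x * gamma_weight s x) - (r * g x - derive1 g x) * gamma_weight (s + 1) x).
  move=> x0.
  apply: (is_derive_eq (is_deriveM (sb_is_derive x sg) (is_derive_gamma_weight s x0))).
  by rewrite /GRing.scale /=; ring.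
have [C C0 HC] := sb_bounded_gt0 sg.
have cvgH (F : set_system R) : Filter F ->
    gamma_weight (s + 1) x @[x --> F] --> (0 : R) -> H x @[x --> F] --> (0 : R).
  move=> FF w0; apply: norm_cvg0.
  apply: (@squeeze_cvgr _ _ _ _ (fun=> 0) (fun x => C * gamma_weight (s + 1) x)).
  - near=> x; rewrite normr_ge0/= /H normrM.
    by rewrite (ger0_norm (gamma_weight_ge0 _ _)) ler_wpM2r ?gamma_weight_ge0.
  - exact: cvg_cst.
  - by rewrite -[X in _ --> X](mulr0 C); apply: cvgM => //; exact: cvg_cst.
have := @integral_derive_itv0y R H _ dH.
move=> /(_ _ _ (cvgH _ _ (gamma_weight_cvg0 s0)) (cvgH _ _ (gamma_weight_cvg_y s0))).
move=> E; apply/esym/eqP; rewrite -subr_eq0 -RintegralZl// -RintegralB//.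
apply/eqP; rewrite /Rintegral E//.
- move=> x x0; apply: differentiable_continuous; apply/derivable1_diffP.
  have dw t : derivable (gamma_weight t) x 1.
    by have := is_derive_gamma_weight (t - 1) x0; rewrite subrK => -[].
  have dg : derivable g x 1 by exact: sb_derivable.
  have dg' : derivable (derive1 g) x 1 by exact: sb_derivable.
  apply: (@derivableB _ _ _ (fun x => s * (g x * gamma_weight s x))
    (fun x => (r * g x - derive1 g x) * gamma_weight (s + 1) x)).
    have dgw : derivable (fun x => g x * gamma_weight s x) x 1.
      exact: derivableM dg (dw s).
    exact: derivableM (derivable_cst _ _ _) dgw.
  apply: derivableM; last exact: dw.
  apply: derivableB; last exact: dg'.
  by apply: derivableM; [exact: derivable_cst|exact: dg].
- by have := integrableB mD i3 i2.
Unshelve. all: by end_near. Qed.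

Lemma Rintegral_gamma_weight_gt0 s : 1 <= s ->
  0 < \int[leb]_(x in D0) gamma_weight s x.
Proof.
move=> s1; have iw := integrable_gamma_weight s1.
have sub : `[1, 2] `<=` D0.
  by move=> x; rewrite /= !in_itv/= andbT => /andP[/(lt_le_trans ltr01)].
have fin1 : (\int[leb]_(x in D0) (gamma_weight s x)%:E)%E \is a fin_num.
  exact: integrable_fin_num iw.
(* On [1, 2] the weight is at least e^(-2r), because s >= 1. *)
rewrite /Rintegral -lte_fin fineK// (@lt_le_trans _ _ (expR (- (r * 2)))%:E)//.
  by rewrite lte_fin expR_gt0.
apply: (@le_trans _ _ (\int[leb]_(x in `[1%R, 2%R]) (gamma_weight s x)%:E)%E); last first.
  apply: ge0_subset_integral => //.
    by apply/measurable_EFinP; exact: measurable_gamma_weight.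
  by move=> x _; rewrite lee_fin gamma_weight_ge0.
rewrite -[leLHS]mule1 (_ : 1%E = leb `[1, 2]%classic); last first.
  by rewrite lebesgue_measure_itv/= lte_fin ltr1n -EFinB; congr EFin; ring.
rewrite -integral_cst//; apply: ge0_le_integral => //.
- by move=> x _; rewrite lee_fin expR_ge0.
- apply/measurable_EFinP; exact: measurable_funS (measurable_gamma_weight s).
- move=> x; rewrite /= in_itv/= => /andP[x1 x2]; rewrite lee_fin.
  rewrite -[leLHS]mul1r ler_pM ?expR_ge0//.
    have p1 : 1 `^ (s - 1) = 1 :> R by rewrite powR1.
    by rewrite -[leLHS]p1 ge0_ler_powR ?nnegrE ?subr_ge0// (le_trans _ x1).
  by rewrite ler_expR lerN2 ler_wpM2l// ltW.
Qed.

End gamma_weight.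

Section avg_operator.
Context {R : realType} d {T : measurableType d} (mu : {measure set T -> \bar R}).
Variable D : set T.
Hypothesis mD : measurable D.
Implicit Types (v k : T -> R) (f : R -> R).

Lemma sb_operator_avg v k : measurable_fun D v -> mu.-integrable D (EFin \o k) ->
  sb_operator (avg mu D (fun=> 1) v k).
Proof.
move=> mv ik.
have m1 : measurable_fun D (fun=> 1 : R) by [].
have le1 w : D w -> `|1 : R| <= 1 by rewrite normr1.
split=> [f sf|a f g sf sg|f sf].
- exact: sb_avg.
- apply/funext => x.
  have intf := integrable_avg mD m1 mv ik x sf.
  have intg := integrable_avg mD m1 mv ik x sg.
  rewrite /avg -RintegralZl// -RintegralD//.
    by apply: eq_Rintegral => w _; ring.
  by have := integrableZl mD a intf.
- apply/funext => x; rewrite derive1E.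
  have [_ ->] := is_derive_avg mD m1 mv le1 ik x sf.
  by apply: eq_Rintegral => w _; rewrite !mul1r.
Qed.

Lemma avg_restrict v k f x :
  avg mu D (fun=> 1) v k f x = avg mu setT (fun=> 1) v (k \_ D) f x.
Proof.
rewrite /avg Rintegral_mkcond; apply: eq_Rintegral => w _.
by rewrite !patchE; case: ifP => // _; rewrite mulr0.
Qed.

End avg_operator.

(** * Commutation of averages by Fubini *)

Section avg_Fubini.
Context {R : realType} d1 d2 {T1 : measurableType d1} {T2 : measurableType d2}.
Variables (m1 : {sigma_finite_measure set T1 -> \bar R})
  (m2 : {sigma_finite_measure set T2 -> \bar R}).
Local Open Scope ereal_scope.

Lemma integrable_prod_bounded (g : T1 * T2 -> R) k1 k2 (C : R) :
    measurable_fun setT g -> (forall z, `|g z| <= C)%R ->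
    m1.-integrable setT (EFin \o k1) -> m2.-integrable setT (EFin \o k2) ->
  (m1 \x m2).-integrable setT (fun z => (g z * (k1 z.1 * k2 z.2))%:E).
Proof.
move=> mg gC i1 i2.
have mk1 : measurable_fun setT k1 by apply/measurable_EFinP/(measurable_int _ i1).
have mk2 : measurable_fun setT k2 by apply/measurable_EFinP/(measurable_int _ i2).
have C0 : (0 <= C)%R by rewrite (le_trans _ (gC (point, point))).
have mk : measurable_fun setT (fun z : T1 * T2 => (k1 z.1 * k2 z.2)%R).
  by apply: measurable_funM; exact: measurableT_comp.
apply: (@integrable_bounded_mul _ _ _ (m1 \x m2) setT _ g _ C) => //.
apply/integrable12ltyP; first exact/measurable_EFinP.
have K1 := (integrableP _ _ _ i1).2; have K2 := (integrableP _ _ _ i2).2.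
rewrite (eq_integral (fun x => `|(k1 x)%:E| * \int[m2]_y `|(k2 y)%:E|)); last first.
  move=> x _; rewrite -ge0_integralZl_EFin//.
  - by apply: eq_integral => y _; rewrite /= normrM EFinM.
  - by apply/measurable_EFinP; exact: measurableT_comp.
rewrite /= ge0_integralZr//; last 2 first.
- by apply/measurable_EFinP; exact: measurableT_comp.
- by apply: integral_ge0.
by apply: lte_mul_pinfty => //; [exact: integral_ge0|rewrite ge0_fin_numE//; exact: integral_ge0].
Qed.

Lemma RintegralE d (T : measurableType d) (mu : {measure set T -> \bar R}) D f :
  mu.-integrable D (EFin \o f) -> measurable D ->
  (\int[mu]_(x in D) f x)%R%:E = \int[mu]_(x in D) (f x)%:E.
Proof. by move=> intf mD; rewrite /Rintegral fineK//; exact: integrable_fin_num. Qed.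

Lemma Rintegral_Fubini (g : T1 * T2 -> R) :
    (forall x, m2.-integrable setT (fun y => (g (x, y))%:E)) ->
    (forall y, m1.-integrable setT (fun x => (g (x, y))%:E)) ->
    (m1 \x m2).-integrable setT (EFin \o g) ->
  (\int[m1]_x \int[m2]_y g (x, y) = \int[m2]_y \int[m1]_x g (x, y))%R.
Proof.
move=> i2 i1 ig; rewrite /Rintegral; congr fine.
transitivity (\int[m1]_x \int[m2]_y (g (x, y))%:E).
  by apply: eq_integral => x _; rewrite fineK//; exact: integrable_fin_num (i2 x).
transitivity (\int[m2]_y \int[m1]_x (g (x, y))%:E).
  exact: (Fubini ig).
by apply: eq_integral => y _; rewrite fineK//; exact: integrable_fin_num (i1 y).
Qed.

(** Either order gives the double integral of f(x + v1 + v2) k1 k2, which is absolutely convergent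
    because f is bounded. *)
Lemma avg_comm v1 k1 v2 k2 : measurable_fun setT v1 -> measurable_fun setT v2 ->
    m1.-integrable setT (EFin \o k1) -> m2.-integrable setT (EFin \o k2) ->
  op_comm (avg m1 setT (fun=> 1%R) v1 k1) (avg m2 setT (fun=> 1%R) v2 k2).
Proof.
move=> mv1 mv2 i1 i2 f sf; apply/funext => x.
have [C HC] := sb_bounded sf.
have mk1 : measurable_fun setT k1 by apply/measurable_EFinP/(measurable_int _ i1).
have mk2 : measurable_fun setT k2 by apply/measurable_EFinP/(measurable_int _ i2).
pose g (z : T1 * T2) := (f (x + v1 z.1 + v2 z.2) * (k1 z.1 * k2 z.2))%R.
have mf : measurable_fun setT (fun z : T1 * T2 => f (x + v1 z.1 + v2 z.2)%R).
  apply: sb_comp_measurable => //.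
  by apply: measurable_funD; [apply: measurable_funD => //|]; exact: measurableT_comp.
have int2 y : m2.-integrable setT (EFin \o (fun w => f (y + v2 w) * k2 w)%R).
  apply: (@integrable_bounded_mul _ _ _ m2 setT _ _ _ C) => //.
  by apply: sb_comp_measurable => //; exact: measurable_funD.
have int1 y : m1.-integrable setT (EFin \o (fun w => f (y + v1 w) * k1 w)%R).
  apply: (@integrable_bounded_mul _ _ _ m1 setT _ _ _ C) => //.
  by apply: sb_comp_measurable => //; exact: measurable_funD.
have ig : (m1 \x m2).-integrable setT (EFin \o g).
  by apply: (integrable_prod_bounded (C := C)).
have := @Rintegral_Fubini g _ _ ig.
have -> : (\int[m1]_x \int[m2]_y g (x, y))%R =
    avg m1 setT (fun=> 1%R) v1 k1 (avg m2 setT (fun=> 1%R) v2 k2 f) x.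
  apply: eq_Rintegral => w1 _; rewrite /g mulrC -RintegralZl//.
  by apply: eq_Rintegral => w2 _ /=; rewrite !mul1r; ring.
have -> : (\int[m2]_y \int[m1]_x g (x, y))%R =
    avg m2 setT (fun=> 1%R) v2 k2 (avg m1 setT (fun=> 1%R) v1 k1 f) x.
  apply: eq_Rintegral => w1 _; rewrite /g mulrC -RintegralZl//.
  by apply: eq_Rintegral => w2 _ /=; rewrite !mul1r [in LHS]addrAC; ring.
apply=> w.
  have := integrableZl measurableT (k1 w) (int2 (x + v1 w)%R).
  by apply: eq_integrable => // z _; rewrite /g -EFinM/=; congr EFin; ring.
have := integrableZl measurableT (k2 w) (int1 (x + v2 w)%R).
apply: eq_integrable => // z _; rewrite /g -EFinM/= [in RHS]addrAC; congr EFin; ring.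
Qed.

End avg_Fubini.

(** * Real powers of 1 - c D *)

Section gamma_operator.
Context {R : realType}.
Notation leb := (@lebesgue_measure R).
Notation D0 := (`]0, +oo[%classic : set (measurableTypeR R)).
Variables (r lam : R).
Hypothesis r0 : 0 < r.
Implicit Types (f eta chi psi : R -> R) (s x : R).

Definition gamma_op s := avg leb D0 (fun=> 1) (fun y => lam * y) (gamma_weight r s).

Let mD : measurable D0. Proof. by []. Qed.
Let mv : measurable_fun D0 (fun y => lam * y). Proof. exact: measurable_funM. Qed.

Lemma sb_operator_gamma s : 1 <= s -> sb_operator (gamma_op s).
Proof. by move=> s1; exact: sb_operator_avg (integrable_gamma_weight r0 s1). Qed.

(** Integration by parts in y, as the y-derivative of f(x + lam y) is lam f'(x + lam y). On the
    level of constants it is the recursion Gamma(s + 1) = s Gamma(s). *)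
Lemma subDerive_gamma_op s f : 1 <= s -> smooth_bounded f ->
  (fun x => r * subDerive (lam / r) (gamma_op (s + 1) f) x) =
  (fun x => s * gamma_op s f x).
Proof.
move=> s1 sf; apply/funext => x.
have s0 : 0 < s by rewrite (lt_le_trans _ s1).
have s2 : 1 <= s + 1 by rewrite lerDr ltW.
have oG := sb_operator_gamma s2.
have sfx : smooth_bounded (fun y => f (lam * y + x)) by exact: sb_affine.
have := gamma_weight_by_parts r0 s0 (integrable_gamma_weight r0 s1) sfx.
have Ex t : \int[leb]_(y in D0) (f (lam * y + x) * gamma_weight r t y) = gamma_op t f x.
  by apply: eq_Rintegral => y _; rewrite mul1r addrC.
rewrite Ex => <-.
rewrite /subDerive -(op_derive oG)// mulrBr mulrA (mulrCA r) divff ?gt_eqF// mulr1.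
have iG h : smooth_bounded h ->
    leb.-integrable D0 (EFin \o (fun y => h (1 * x + lam * y) * gamma_weight r (s + 1) y)).
  by move=> sh; apply: integrable_avg => //; exact: integrable_gamma_weight.
have sf' := sb_derive sf.
rewrite /gamma_op /avg -!RintegralZl ?iG// -RintegralB//.
- apply: eq_Rintegral => y _; rewrite derive1_affine; last exact: sb_derivable.
  by rewrite mul1r (addrC x); ring.
- by have := integrableZl mD r (iG _ sf).
- by have := integrableZl mD lam (iG _ sf').
Qed.

(** The argument x + lam y splits into x and lam y, and the factor y raises the parameter of the
    weight by one. *)
Lemma decomp_gamma_op s eta chi psi : 1 <= s -> decomp eta chi psi ->
  decomp (gamma_op s eta) (gamma_op s chi)
    (fun x => lam * gamma_op (s + 1) chi x + gamma_op s psi x).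
Proof.
move=> s1 [se sc sp E]; have s2 : 1 <= s + 1 by rewrite lerDr (le_trans _ s1).
have oG := sb_operator_gamma s1; have oG2 := sb_operator_gamma s2.
split; [exact: op_sb|exact: op_sb|by apply: sb_lin; exact: op_sb|move=> x].
have iG h t : 1 <= t -> smooth_bounded h ->
    leb.-integrable D0 (EFin \o (fun y => h (1 * x + lam * y) * gamma_weight r t y)).
  by move=> t1 sh; apply: integrable_avg => //; exact: integrable_gamma_weight.
have i1 := iG _ _ s1 sc; have i2 := iG _ _ s2 sc; have i3 := iG _ _ s1 sp.
have i1' : leb.-integrable D0 (EFin \o (fun y => x * (chi (1 * x + lam * y) * gamma_weight r s y))).
  by have := integrableZl mD x i1.
have i2' : leb.-integrable D0 (EFin \o (fun y => lam * (chi (1 * x + lam * y) * gamma_weight r (s + 1) y))).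
  by have := integrableZl mD lam i2.
rewrite /gamma_op /avg -!RintegralZl// -RintegralD// -RintegralD//; last first.
  by have := integrableD mD i2' i3.
apply: eq_Rintegral => y; rewrite inE/= in_itv/= andbT => y0.
by rewrite E gamma_weightS//; ring.
Qed.

(* Up to a positive constant, [gamma_op s] is (1 - c D)^(-s) with c = lam / r, so
   that for a = n + 1 - s the operator [gamma_inv n s] is (1 - c D)^(a - 1). *)
Definition gamma_inv n s f := iter n (subDerive (lam / r)) (gamma_op s f).

Lemma sb_operator_gamma_inv n s : 1 <= s -> sb_operator (gamma_inv n s).
Proof.
move=> s1; have := sb_operator_comp
  (sb_operator_iter n (sb_operator_subDerive (lam / r))) (sb_operator_gamma s1).
by [].
Qed.

(** The n + 1 differential factors contribute - (n + 1) c and the averaging contributes + s c, each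
    times [gamma_inv] of chi. *)
Lemma twisted_gamma_inv n s : 1 <= s ->
  twisted (subDerive (lam / r) \o gamma_inv n s) (gamma_inv n s)
    ((n.+1%:R - s) * (lam / r)).
Proof.
move=> s1 eta chi psi E x.
have s2 : 1 <= s + 1 by rewrite lerDr (le_trans _ s1).
have oG := sb_operator_gamma s1; have oG2 := sb_operator_gamma s2.
have oI m := sb_operator_iter m (sb_operator_subDerive (lam / r)).
have [_ sc sp _] := E.
have E' := decomp_gamma_op s1 E.
have := twisted_iter_subDerive (lam / r) n E' x.
rewrite (op_lin (oI _)); [|exact: op_sb..].
(* One of the n + 1 factors is spent on lowering the parameter s + 1 back to s. *)
have -> : lam * iter n.+1 (subDerive (lam / r)) (gamma_op (s + 1) chi) x =
    s * (lam / r) * iter n (subDerive (lam / r)) (gamma_op s chi) x.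
  rewrite iterSr.
  have sL : smooth_bounded (subDerive (lam / r) (gamma_op (s + 1) chi)).
    by apply: (op_sb (sb_operator_subDerive _)); exact: op_sb.
  have := congr1 (fun g => g x) (opZ r (oI n) sL).
  have -> : (fun y => r * subDerive (lam / r) (gamma_op (s + 1) chi) y) =
     (fun y => s * gamma_op s chi y) by exact: subDerive_gamma_op.
  rewrite (opZ _ (oI n))/=; last exact: op_sb.
  move=> H; apply: (mulfI (lt0r_neq0 r0)).
  by rewrite mulrCA -H; field; rewrite gt_eqF.
rewrite /= /gamma_inv => ->; ring.
Qed.

End gamma_operator.

(** * Approximation by Schwartz functions *)

Section sigmoid.
Context {R : realType}.
Implicit Types (p : {poly R}) (x : R) (f : R -> R).

(* All derivatives of the sigmoid S are polynomials in S, because S' = S (1 - S). *)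
Definition sigmoid x : R := (1 + expR (- x))^-1.

Lemma sigmoid_gt0 x : 0 < sigmoid x.
Proof. by rewrite invr_gt0 ltr_pwDl// expR_ge0. Qed.

Lemma sigmoid_lt1 x : sigmoid x < 1.
Proof. by rewrite invf_lt1 ?ltrDl ?expR_gt0// ltr_pwDl// expR_ge0. Qed.

Lemma onem_sigmoid x : 1 - sigmoid x = expR (- x) * sigmoid x.
Proof.
rewrite /sigmoid; field.
by rewrite gt_eqF// ltr_pwDl// expR_ge0.
Qed.

Lemma is_derive_sigmoid x : is_derive x (1 : R) sigmoid (sigmoid x * (1 - sigmoid x)).
Proof.
have n0 : 1 + expR (- x) != 0 by rewrite gt_eqF// ltr_pwDl// expR_ge0.
have de : is_derive x (1 : R) (fun x : R => expR (- x)) (- expR (- x)).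
  apply: (is_derive_eq (@is_derive1_comp _ expR -%R x _ _ _ _)).
  by rewrite mulrN1.
have d1 : is_derive x (1 : R) (fun x : R => 1 + expR (- x)) (- expR (- x)).
  by apply: (is_derive_eq (is_deriveD _ de)); rewrite add0r.
apply: (is_derive_eq (@is_deriveV _ (fun x : R => 1 + expR (- x)) _ _ _ n0 d1)).
by rewrite onem_sigmoid /sigmoid /GRing.scale /=; field.
Qed.

Lemma is_derive_horner_sigmoid p x : is_derive x (1 : R) (fun x => p.[sigmoid x])
  (p^`() * ('X * (1 - 'X))).[sigmoid x].
Proof.
have dp : is_derive (sigmoid x) (1 : R) (horner p) (p^`()).[sigmoid x].
  by apply: DeriveDef; [exact: derivable_horner|rewrite -derive1E derivE].
apply: (is_derive_eq (@is_derive1_comp _ (horner p) sigmoid x _ _ dp (is_derive_sigmoid x))).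
by rewrite !hornerE.
Qed.

Lemma horner_sigmoid_bounded p : unif_bounded (fun x => p.[sigmoid x]).
Proof.
exists (\sum_(i < size p) `|p`_i|) => x; rewrite horner_coef.
rewrite (le_trans (ler_norm_sum _ _ _))// ler_sum// => i _.
rewrite normrM -[leRHS]mulr1 ler_wpM2l// normrX exprn_ile1//.
by rewrite gtr0_norm ?sigmoid_gt0// ltW// sigmoid_lt1.
Qed.

Lemma sb_horner_sigmoid p : smooth_bounded (fun x => p.[sigmoid x]).
Proof.
apply: (@smooth_in_coind _ _ [set f | exists p : {poly R}, f = fun x => p.[sigmoid x]]).
  move=> _ [{}p ->]; split.
  - by move=> x; have [] := is_derive_horner_sigmoid p x.
  - exact: horner_sigmoid_bounded.
  - exists (p^`() * ('X * (1 - 'X))); apply/funext => x; rewrite derive1E.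
    by have [_ ->] := is_derive_horner_sigmoid p x.
by exists p.
Qed.

Lemma sb_sigmoid : smooth_bounded sigmoid.
Proof.
by have := sb_horner_sigmoid 'X; congr smooth_bounded; apply/funext => x; rewrite hornerX.
Qed.

Lemma sigmoid_bump_le x : sigmoid x * (1 - sigmoid x) <= expR (- `|x|).
Proof.
have s1 := ltW (sigmoid_lt1 x); have s0 := ltW (sigmoid_gt0 x).
have [x0|x0] := leP 0 x.
  rewrite ger0_norm// onem_sigmoid mulrCA -[leRHS]mulr1 ler_wpM2l ?expR_ge0//.
  by rewrite -[leRHS]mulr1 ler_pM.
rewrite ltr0_norm// opprK.
have {1}-> : sigmoid x = expR x * (1 - sigmoid x).
  by rewrite onem_sigmoid mulrA -expRD subrr expR0 mul1r.
by rewrite -mulrA -[leRHS]mulr1 ler_wpM2l ?expR_ge0// -[leRHS]mulr1 ler_pM ?subr_ge0// gerBl.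
Qed.

(* The factor 4 makes the value at 0 equal to 1. *)
Lemma schwartz_sigmoid_bump : schwartz (fun x => 4 * (sigmoid x * (1 - sigmoid x))).
Proof.
apply/schwartzP.
(* Divisibility by X (1 - X) persists under differentiation because S' = S (1 - S), and this factor
   is the one that decays. *)
apply: (@smooth_in_coind _ _ [set f | exists p : {poly R},
    f = fun x => (p * ('X * (1 - 'X))).[sigmoid x]]); last first.
  by exists (4%:R)%:P; apply/funext => x; rewrite !hornerE.
move=> _ [p ->]; split.
- by move=> x; have [] := is_derive_horner_sigmoid (p * ('X * (1 - 'X))) x.
- move=> k; have [C HC] := horner_sigmoid_bounded p.
  have C0 : 0 <= C by rewrite (le_trans _ (HC 0)).
  exists (C * k`!%:R) => x; rewrite hornerM [('X * _).[_]](_ : _ = sigmoid x * (1 - sigmoid x));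
    last by rewrite !hornerE.
  rewrite normrM mulrCA ler_pM ?mulr_ge0 ?exprn_ge0//.
  have b0 : 0 <= sigmoid x * (1 - sigmoid x).
    by rewrite mulr_ge0 ?subr_ge0 ?(ltW (sigmoid_lt1 x))// ltW// sigmoid_gt0.
  rewrite (ger0_norm b0) (le_trans (ler_wpM2l _ (sigmoid_bump_le x))) ?exprn_ge0//.
  rewrite expRN ler_pdivrMr ?expR_gt0//.
  (* A single term of the exponential series gives |x|^k <= k! e^|x|; exponent 0 is treated
     apart. *)
  case: k => [|k]; first by rewrite fact0 expr0 mul1r -expR0 ler_expR.
  rewrite -ler_pdivrMl ?ltr0n ?fact_gt0// mulrC.
  by rewrite (le_trans _ (expR_ge1Dxn k (normr_ge0 x)))// lerDr.
- exists (p * ('X * (1 - 'X)))^`(); apply/funext => x; rewrite derive1E.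
  by have [_ ->] := is_derive_horner_sigmoid (p * ('X * (1 - 'X))) x.
Qed.

End sigmoid.

(** * Cut-off by a dilated bump *)

Section schwartz_approximation.
Context {R : realType}.
Implicit Types (phi rho : R -> R) (x : R).

Lemma derive1n_lin (a : R) f g l : smooth_bounded f -> smooth_bounded g ->
  derive1n l (fun x => a * f x + g x) = fun x => a * derive1n l f x + derive1n l g x.
Proof.
elim: l f g => // l IH f g sf sg.
rewrite !derive1Sn -IH; [|exact: sb_derive..].
congr derive1n; apply/funext => x; rewrite derive1_lin//; exact: sb_derivable.
Qed.

(** A derivative falling on the cut-off carries a factor 1/(n+1), at most 1 and vanishing in the
    limit. The induction replaces [rho] by its derivative, so the limit is stated with [rho 0]
    instead of 1. *)
Lemma derive1n_cutoff l phi rho : smooth_bounded phi -> smooth_bounded rho ->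
  let f n x := phi x * rho (n.+1%:R^-1 * x + 0) in
  (exists C, forall n x, `|derive1n l (f n) x| <= C) /\
  forall x, derive1n l (f n) x @[n --> \oo] --> rho 0 * derive1n l phi x.
Proof.
elim: l phi rho => [|l IH] phi rho sp sr f.
  split.
    have [C HC] := sb_bounded sp; have [C' HC'] := sb_bounded sr.
    by exists (C * C') => n x; rewrite normrM ler_pM.
  move=> x; rewrite mulrC; apply: cvgM; first exact: cvg_cst.
  apply: (@continuous_cvg _ _ _ _ _ (fun n => n.+1%:R^-1 * x + 0) rho).
    exact: (sb_continuous sr).
  have : n.+1%:R^-1 * x + 0 @[n --> \oo] --> 0 * x + 0.
    apply: cvgD; last exact: cvg_cst.
    by apply: cvgM; [exact: cvg_harmonic|exact: cvg_cst].
  by rewrite mul0r addr0.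
have sp' := sb_derive sp; have sr' := sb_derive sr.
have [[C1 H1] L1] := IH _ _ sp sr'; have [[C2 H2] L2] := IH _ _ sp' sr.
have E n : derive1n l.+1 (f n) = fun x => n.+1%:R^-1 *
      derive1n l (fun x => phi x * derive1 rho (n.+1%:R^-1 * x + 0)) x +
    derive1n l (fun x => derive1 phi x * rho (n.+1%:R^-1 * x + 0)) x.
  rewrite derive1Sn -derive1n_lin.
  - congr derive1n; apply/funext => x; rewrite derive1_mul.
    + rewrite derive1_affine; last exact: sb_derivable.
      by rewrite addrC; congr (_ + _); ring.
    + exact: sb_derivable.
    + by apply: sb_derivable; exact: sb_affine.
  - by apply: sbM => //; exact: sb_affine.
  - by apply: sbM => //; exact: sb_affine.
split.
  exists (C1 + C2) => n x; rewrite E (le_trans (ler_normD _ _))// lerD//.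
  rewrite normrM -[leRHS]mul1r ler_pM//.
  by rewrite ger0_norm// invf_le1// ler1n.
move=> x; under eq_fun do rewrite E.
rewrite (_ : rho 0 * derive1n l.+1 phi x = 0 * (derive1 rho 0 * derive1n l phi x) +
    rho 0 * derive1n l (derive1 phi) x); last by rewrite derive1Sn mul0r add0r.
apply: cvgD => //; apply: cvgM => //.
exact: cvg_harmonic.
Qed.

Lemma schwartz_approx phi : smooth_bounded phi -> exists f : nat -> R -> R,
  (forall n, schwartz (f n)) /\ forall l,
  (exists C, forall n x, `|derive1n l (f n) x| <= C) /\
  forall x, derive1n l (f n) x @[n --> \oo] --> derive1n l phi x.
Proof.
move=> sp; pose rho := (fun x : R => 4 * (sigmoid x * (1 - sigmoid x))).
have srho : smooth_bounded rho by apply: schwartz_smooth_bounded; exact: schwartz_sigmoid_bump.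
exists (fun n x => phi x * rho (n.+1%:R^-1 * x + 0)); split; last first.
  move=> l; have [H1 H2] := derive1n_cutoff l sp srho; split => // x.
  have r0 : rho 0 = 1 by rewrite /rho /sigmoid oppr0 expR0; field.
  by have := H2 x; rewrite r0 mul1r.
move=> n.
have -> : (fun x => phi x * rho (n.+1%:R^-1 * x + 0)) =
   (fun x => rho (n.+1%:R^-1 * x + 0) * phi x) by apply/funext => x; rewrite mulrC.
apply: schwartzM => //; apply: schwartz_affine; first exact: lt0r_neq0.
exact: schwartz_sigmoid_bump.
Qed.

End schwartz_approximation.

(** * The Stein identity determines the law *)

Section Hadamard.
Context {R : realType}.
Notation leb := (@lebesgue_measure R).

(** The quotient (eta x - eta 0) / x is taken as the integral of eta'(t x) over t in [0, 1], so that
    its smoothness at 0 and its bounds come from [sb_avg]. *)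
Lemma decomp_at0 (eta : R -> R) : smooth_bounded eta ->
  exists chi, decomp eta chi (fun=> eta 0).
Proof.
move=> se; have se' := sb_derive se.
set D1 : set (measurableTypeR R) := `[0%R, 1%R]%classic.
have mD : measurable D1 by exact: measurable_itv.
have fD : (leb D1 < +oo)%E by rewrite lebesgue_measure_itv/= lte_fin ltr01 ltry.
have i1 : leb.-integrable D1 (EFin \o (fun=> 1)).
  by apply: measurable_bounded_integrable => //; exact: bounded_cst.
have mid : measurable_fun D1 (fun t => t) by exact: measurable_id.
have m0 : measurable_fun D1 (fun=> 0 : R) by [].
have le1 w : D1 w -> `|w| <= 1 by rewrite /D1/= in_itv/= => /andP[w0 w1]; rewrite ger0_norm.
exists (avg leb D1 (fun t => t) (fun=> 0) (fun=> 1) (derive1 eta)).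
split => //; [exact: sb_avg|exact: sb_cst|move=> x].
have int := integrable_avg mD mid m0 i1 x se'.
rewrite /avg -RintegralZl//; apply/eqP; rewrite -subr_eq; apply/eqP.
pose F t := eta (x * t + 0).
have sF : smooth_bounded F by exact: sb_affine.
rewrite /Rintegral.
have -> : (\int[leb]_(t in D1) (x * (derive1 eta (t * x + 0) * 1))%:E =
    \int[leb]_(t in D1) (derive1 F t)%:E)%E.
  apply: eq_integral => t _; rewrite derive1_affine; last exact: sb_derivable.
  by rewrite mulr1 (mulrC t).
rewrite (@continuous_FTC2 _ (derive1 F) F 0 1)//.
- by rewrite /F mulr1 mulr0 !addr0.
- by apply: continuous_subspaceT; exact: (sb_continuous (sb_derive sF)).
- split.
  + by move=> t _; exact: sb_derivable.
  + by apply: cvg_at_right_filter; exact: (sb_continuous sF).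
  + by apply: cvg_at_left_filter; exact: (sb_continuous sF).
Qed.

End Hadamard.

(** * Evaluation of W at a solution of the Stein identity *)

Section stein_uniqueness.
Context {R : realType} (I : eqType).
Variables (c a : I -> R) (s : seq I).

Definition stein_identity d (T : measurableType d) (P : probability T R) (X : T -> R) :=
  forall phi, smooth_bounded phi ->
  \int[P]_w (X w * subDerives c s phi (X w)) =
  \sum_(k <- s) a k * c k * \int[P]_w subDerives c (rem k s) phi (X w).

Variable V : I -> (R -> R) -> R -> R.
Hypothesis us : uniq s.
Hypothesis oV : forall i, sb_operator (V i).
Hypothesis tV : forall i, twisted (subDerive (c i) \o V i) (V i) (a i * c i).
Hypothesis V1 : forall i, exists2 K : R, K != 0 & V i (fun=> 1) = fun=> K.
Hypothesis shiftV : forall b i, op_comm (fun f x => f (x + b)) (V i).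

Let W f := subDerives c s (op_prod V s f).

Let oW : sb_operator W.
Proof. exact: sb_operator_comp (sb_operator_subDerives _ _) (sb_operator_prod oV _). Qed.

Lemma W1 : exists2 K : R, K != 0 & W (fun=> 1) = fun=> K.
Proof.
have L1 c' K : subDerive c' (fun=> K : R) = fun=> K.
  by apply/funext => x; rewrite /subDerive derive1_cst mulr0 subr0.
have S1 t K : subDerives c t (fun=> K) = fun=> K by elim: t => //= j t ->; rewrite L1.
suff [K K0 PK] : exists2 K : R, K != 0 & op_prod V s (fun=> 1) = fun=> K.
  by exists K => //; rewrite /W PK S1.
elim: s => [|j t [K K0 IH]]; first by exists 1.
have [K' K'0 H] := V1 j; exists (K * K'); first by rewrite mulf_neq0.
rewrite /= IH; have -> : (fun=> K) = (fun x : R => K * (fun=> 1) x).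
  by apply/funext => x; rewrite mulr1.
by rewrite (opZ _ (oV j)) ?H//; exact: sb_cst.
Qed.

Section eval.
Context d (T : measurableType d) (P : probability T R) (X : T -> R).
Hypothesis mX : measurable_fun setT X.
Hypothesis iX : P.-integrable setT (EFin \o X).
Hypothesis steinX : stein_identity P X.

Lemma integrable_sb f : smooth_bounded f -> P.-integrable setT (EFin \o (fun w => f (X w))).
Proof.
move=> sf; have [C HC] := sb_bounded sf.
apply: measurable_bounded_integrable => //.
- by rewrite (le_lt_trans (probability_le1 _ _))// ltry.
- exact: sb_comp_measurable.
- by exists C; split; [exact: num_real|move=> M CM w _ /=; rewrite (le_trans (HC _))// ltW].
Qed.

Lemma integrable_sbX f : smooth_bounded f ->
  P.-integrable setT (EFin \o (fun w => X w * f (X w))).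
Proof.
move=> sf; have [C HC] := sb_bounded sf.
have := @integrable_bounded_mul _ _ _ P setT measurableT (f \o X) X C.
move=> /(_ (sb_comp_measurable sf mX) (fun w _ => HC (X w)) iX).
by apply: eq_integrable => // w _ /=; rewrite mulrC.
Qed.

Lemma stein_eval eta K : smooth_bounded eta -> W (fun=> 1) = (fun=> K) ->
  \int[P]_w W eta (X w) = K * eta 0.
Proof.
move=> se W1K; have [chi E] := decomp_at0 se; have [_ sc _ _] := E.
have sV : smooth_bounded (op_prod V s chi) by exact: op_sb (sb_operator_prod oV _) _ sc.
have sR k : smooth_bounded (subDerives c (rem k s) (op_prod V s chi)).
  exact: op_sb (sb_operator_subDerives _ _) _ sV.
have sS : smooth_bounded (subDerives c s (op_prod V s chi)).
  exact: op_sb (sb_operator_subDerives _ _) _ sV.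
have WE w : W eta (X w) = X w * subDerives c s (op_prod V s chi) (X w) -
    \sum_(k <- s) a k * c k * subDerives c (rem k s) (op_prod V s chi) (X w) + K * eta 0.
  (* The remainder in Hadamard's decomposition is the constant [eta 0], which [W] sends to
     [K * eta 0]. *)
  rewrite /W (twisted_prod oV tV us E); congr (_ + _).
  have -> : K * eta 0 = W (fun x => eta 0 * (fun=> 1) x) (X w).
    by rewrite (opZ (eta 0) oW (sb_cst 1)) W1K mulrC.
  rewrite /W; congr (subDerives _ _ (op_prod _ _ _) _).
  by apply/funext => x; rewrite mulr1.
have iS := integrable_sbX sS.
have iR k := integrable_sb (sR k).
have isum : P.-integrable setT (EFin \o (fun w =>
    \sum_(k <- s) a k * c k * subDerives c (rem k s) (op_prod V s chi) (X w))).
  apply: (@integrable_sb (fun x =>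
    \sum_(k <- s) a k * c k * subDerives c (rem k s) (op_prod V s chi) x)).
  by apply: sb_sum => k; exact: sbZ.
have iaR k : P.-integrable setT (EFin \o
    (fun w => a k * c k * subDerives c (rem k s) (op_prod V s chi) (X w))).
  exact: (integrable_sb (sbZ _ (sR k))).
have sumE : \int[P]_w \sum_(k <- s)
      a k * c k * subDerives c (rem k s) (op_prod V s chi) (X w) =
    \sum_(k <- s) a k * c k * \int[P]_w subDerives c (rem k s) (op_prod V s chi) (X w).
  by rewrite Rintegral_sum//; apply: eq_bigr => k _; rewrite RintegralZl.
under eq_Rintegral do rewrite WE.
rewrite RintegralD//; last 2 first.
- by have := integrableB measurableT iS isum.
- exact: (integrable_sb (sb_cst (K * eta 0))).
(* The Stein identity with test function [op_prod V s chi] cancels everything that involves chi. *)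
rewrite RintegralB// steinX// sumE subrr add0r Rintegral_cst//.
by rewrite (_ : fine (P setT) = 1) ?mulr1// probability_setT.
Qed.

End eval.

Lemma stein_unique d1 (T1 : measurableType d1) (P1 : probability T1 R) (X1 : T1 -> R)
    d2 (T2 : measurableType d2) (P2 : probability T2 R) (X2 : T2 -> R) :
    measurable_fun setT X1 -> measurable_fun setT X2 ->
    P1.-integrable setT (EFin \o X1) -> P2.-integrable setT (EFin \o X2) ->
    stein_identity P1 X1 -> stein_identity P2 X2 ->
    (forall i, op_comm (avg P2 setT (fun=> 1) X2 (fun=> 1)) (V i)) ->
  forall h, smooth_bounded h -> \int[P1]_w h (X1 w) = \int[P2]_w h (X2 w).
Proof.
move=> mX1 mX2 iX1 iX2 st1 st2 AV h sh.
set A := avg P2 setT (fun=> 1) X2 (fun=> 1).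
have oA : sb_operator A.
  have := integrable_sb P2 mX2 (sb_cst 1).
  exact: sb_operator_avg.
have [K K0 WK] := W1.
have AW f : smooth_bounded f -> A (W f) = W (A f).
  move=> sf; rewrite /W (op_comm_subDerives _ _ oA); last exact: op_sb (sb_operator_prod oV _) _ sf.
  by rewrite (op_comm_prod oV s oA AV).
have WA x : W (A h) x = K * h x.
  rewrite -AW//.
  have shx : smooth_bounded (fun y => h (y + x)) by exact: sb_shift.
  (* The evaluation for [X2] is applied to the translate of h by x, whose value at 0 is h x; W
     commutes with translations. *)
  have := stein_eval mX2 iX2 st2 shx WK; rewrite add0r => <-.
  have oSh := sb_operator_shift (R := R) x.
  have -> : W (fun y => h (y + x)) = fun y => W h (y + x).
    rewrite /W -(op_comm_prod oV s oSh (shiftV x) sh).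
    by rewrite -(op_comm_subDerives c s oSh)//; exact: op_sb (sb_operator_prod oV _) _ sh.
  by apply: eq_Rintegral => w _; rewrite mul1r mulr1 addrC.
(* Now the evaluation for [X1] with eta = A h, whose value at 0 is the expectation of h(X2). *)
have := stein_eval mX1 iX1 st1 (op_sb oA sh) WK.
under eq_Rintegral do rewrite WA.
rewrite RintegralZl//; last exact: (integrable_sb P1 mX1 sh).
move=> /(mulfI K0) ->.
by apply: eq_Rintegral => w _; rewrite mul1r mulr1 add0r.
Qed.

End stein_uniqueness.

(** * Smooth bounded test functions determine the law *)

Section law_ext.
Context {R : realType}.

Lemma sigmoid_le_expR (x : R) : sigmoid x <= expR x.
Proof.
have -> : sigmoid x = expR x * (1 - sigmoid x).
  by rewrite onem_sigmoid mulrA -expRD subrr expR0 mul1r.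
by rewrite -[leRHS]mulr1 ler_wpM2l ?expR_ge0// gerBl ltW// sigmoid_gt0.
Qed.

Lemma expRN_le (x : R) n : n%:R <= x -> expR (- x) <= n.+1%:R^-1.
Proof.
move=> nx; rewrite expRN lef_pV2 ?posrE ?expR_gt0 ?ltr0n//.
by rewrite (le_trans _ (expR_ge1Dx x))// -natr1 addrC lerD2l.
Qed.

(* The extra [n.+1] in the argument makes the limit 1 at [y = t] as well. *)
Definition steep (t : R) n (y : R) : R :=
  sigmoid (n.+1%:R ^+ 2 * y + (n.+1%:R - n.+1%:R ^+ 2 * t)).

Lemma cvg_steep (t y : R) : steep t n y @[n --> \oo] --> (\1_(`[t, +oo[) y : R).
Proof.
(* In this form the argument is at least n + 1 if y >= t, and at most - (n + 1) as soon as (n + 1)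
   (t - y) >= 2. *)
have E n : n.+1%:R ^+ 2 * y + (n.+1%:R - n.+1%:R ^+ 2 * t) =
    n.+1%:R * (n.+1%:R * (y - t) + 1) :> R by ring.
rewrite indicE; have [ty|yt] := leP t y.
  rewrite mem_set/= ?in_itv/= ?ty//.
  apply/cvgrPdist_le => e e0; near=> n.
  rewrite /steep E ger0_norm ?subr_ge0 ?(ltW (sigmoid_lt1 _))// onem_sigmoid.
  set u := n.+1%:R * (_ + 1).
  have nu : n%:R <= u.
    rewrite (@le_trans _ _ (n.+1%:R * 1))//; first by rewrite mulr1 ler_nat.
    by rewrite /u ler_wpM2l// lerDr mulr_ge0// subr_ge0.
  rewrite (@le_trans _ _ (n.+1%:R^-1))//.
    rewrite -[leRHS]mulr1 ler_pM ?expR_ge0 ?(ltW (sigmoid_gt0 _)) ?(ltW (sigmoid_lt1 _))//.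
    exact: expRN_le.
  near: n; move/cvgrPdist_le : (@cvg_harmonic R) => /(_ e e0).
  by apply: filterS => n; rewrite sub0r normrN => /(le_trans (ler_norm _)).
rewrite memNset/=; last by rewrite in_itv/= andbT; apply/negP; rewrite -ltNge.
apply/cvgrPdist_le => e e0; near=> n.
rewrite /steep E sub0r normrN ger0_norm ?(ltW (sigmoid_gt0 _))//.
set u := n.+1%:R * (_ + 1).
have nu : n%:R <= - u.
  rewrite (@le_trans _ _ (n.+1%:R * 1))//; first by rewrite mulr1 ler_nat.
  rewrite /u -mulrN ler_wpM2l// opprD -mulrN opprB lerBrDr.
  rewrite -ler_pdivrMr ?subr_gt0// (@le_trans _ _ n%:R) ?ler_nat//.
  near: n; exact: nbhs_infty_ger.
rewrite (le_trans (sigmoid_le_expR _))// (@le_trans _ _ (n.+1%:R^-1))//.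
  by rewrite -[u]opprK; exact: expRN_le.
near: n; move/cvgrPdist_le : (@cvg_harmonic R) => /(_ e e0).
by apply: filterS => n; rewrite sub0r normrN => /(le_trans (ler_norm _)).
Unshelve. all: by end_near. Qed.

Lemma sb_steep t n : smooth_bounded (steep t n).
Proof. by apply: sb_affine; exact: sb_sigmoid. Qed.

Lemma cvg_integral_steep d (T : measurableType d) (P : probability T R)
    (X : {RV P >-> R}) t :
  (\int[P]_w (steep t n (X w))%:E @[n --> \oo] --> distribution P X `[t, +oo[)%E.
Proof.
have mX : measurable_fun setT X by [].
have mA : measurable (X @^-1` `[t, +oo[) by rewrite -[X in measurable X]setTI; exact: mX.
have -> : distribution P X `[t, +oo[ = (\int[P]_w (\1_(X @^-1` `[t, +oo[) w)%:E)%E.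
  by rewrite integral_indic// setIT.
have [|||||_ _ //] := @dominated_convergence _ _ _ P setT measurableT
  (fun n w => (steep t n (X w))%:E) (fun w => (\1_(X @^-1` `[t, +oo[) w)%:E) (cst 1%E).
- by move=> n; apply/measurable_EFinP; apply: sb_comp_measurable => //; exact: sb_steep.
- by apply/measurable_EFinP.
- apply: aeW => w _; apply: cvg_EFin; first exact: nearW.
  by have := @cvg_steep t (X w); rewrite /comp.
- by have := @integrable_sb _ _ _ P X mX _ (sb_cst 1).
- apply: aeW => w n _ /=; rewrite lee_fin ger0_norm.
    by rewrite ltW// sigmoid_lt1.
  by rewrite ltW// sigmoid_gt0.
Qed.

(** The half-lines [t, +oo[ form a generating pi-system, and their probabilities are limits of
    expectations of the smooth bounded functions [steep t n]. *)
Lemma same_lawP d1 (T1 : measurableType d1) (P1 : probability T1 R) (X1 : {RV P1 >-> R})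
    d2 (T2 : measurableType d2) (P2 : probability T2 R) (X2 : {RV P2 >-> R}) :
  (forall h, smooth_bounded h -> \int[P1]_w h (X1 w) = \int[P2]_w h (X2 w)) ->
  same_law X1 X2.
Proof.
move=> H A mA.
apply: (measure_unique (@RGenCInfty.G R) (fun n => `[- n%:R, +oo[%classic)) => //.
- exact: RGenCInfty.measurableE.
- move=> _ _ [x ->] [y ->]; exists (Num.max x y).
  apply/seteqP; split => z; rewrite /= !in_itv/= !andbT ge_max.
    by move=> [-> ->].
  by move=> /andP.
- by move=> n; exists (- n%:R).
- apply/seteqP; split => // z _; exists (Num.bound `|z|) => //.
  by rewrite /= in_itv/= andbT lerNl -normrN (le_trans (ler_norm _))// normrN ltW// archi_boundP.
- move=> _ [t ->].
  have := @cvg_integral_steep _ _ P2 X2 t.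
  rewrite (_ : (fun n => _) = fun n => (\int[P1]_w (steep t n (X1 w))%:E)%E); last first.
    apply/funext => n; rewrite -!RintegralE ?H//.
    + exact: sb_steep.
    + exact: integrable_sb (sb_steep t n).
    + exact: integrable_sb (sb_steep t n).
  exact: cvg_unique (@cvg_integral_steep _ _ P1 X1 t).
- by move=> n; rewrite (le_lt_trans (probability_le1 _ _)) ?ltry.
Qed.

End law_ext.

(** * The Stein identity for combinations of independent gamma variables *)

Section density.
Context {R : realType}.
Notation leb := (@lebesgue_measure R).
Local Notation RB := (measurableTypeR R).
Local Open Scope ereal_scope.
Variables (nu : probability RB R) (h : RB -> R).
Hypothesis mh : measurable_fun setT h.
Hypothesis h0 : forall x, (0 <= h x)%R.
Hypothesis nuE : forall A, measurable A -> nu A = \int[leb]_(x in A) (h x)%:E.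

Let dom : nu `<< leb.
Proof.
apply/null_content_dominatesP => A mA A0; rewrite nuE//.
by apply: null_set_integral => //; apply/measurable_EFinP; exact: measurable_funTS.
Qed.

Let ae_density : ae_eq leb setT (Radon_Nikodym_SigmaFinite.f nu leb) (EFin \o h).
Proof.
apply: integral_ae_eq => //.
- exact: Radon_Nikodym_SigmaFinite.f_integrable.
- exact/measurable_EFinP.
- by move=> E _ mE; rewrite -(Radon_Nikodym_SigmaFinite.f_integral dom mE); exact: nuE.
Qed.

(** The Radon-Nikodym derivative of [nu] has the same integral as [h] over every measurable set,
    hence equals it almost everywhere and may be replaced by it in the change of variables. *)
Lemma ge0_integral_density (f : RB -> \bar R) : measurable_fun setT f ->
  (forall x, 0 <= f x) -> \int[nu]_x f x = \int[leb]_x (f x * (h x)%:E).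
Proof.
move=> mf f0; rewrite -(Radon_Nikodym_SigmaFinite.change_of_variables dom)//.
have mg := measurable_int _ (Radon_Nikodym_SigmaFinite.f_integrable dom).
apply: ae_eq_integral => //.
- exact: emeasurable_funM.
- by apply: emeasurable_funM => //; exact/measurable_EFinP.
- exact: ae_eqe_mul2l.
Qed.

Lemma integral_density (f : RB -> \bar R) : nu.-integrable setT f ->
  \int[nu]_x f x = \int[leb]_x (f x * (h x)%:E).
Proof.
move=> intf; have mf := measurable_int _ intf.
rewrite integralE ge0_integral_density//; last exact: measurable_funepos.
rewrite ge0_integral_density//; last exact: measurable_funeneg.
rewrite [RHS]integralE; congr (_ - _); apply: eq_integral => x _.
  by rewrite funeposE [RHS]funeposE maxe_pMl ?lee_fin// mul0e.
by rewrite funenegE [RHS]funenegE maxe_pMl ?lee_fin// mul0e mulNe.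
Qed.

End density.

(** * The Stein identity of one gamma variable *)

Section gamma_law.
Context {R : realType} d (T : measurableType d) (P : probability T R).
Variables (X : {RV P >-> R}) (a b : R).
Hypotheses (a0 : 0 < a) (b0 : 0 < b) (lawX : has_gamma_law X a b).
Notation leb := (@lebesgue_measure R).
Local Notation RB := (measurableTypeR R).
Notation D0 := (`]0, +oo[%classic : set RB).

Let K := b `^ a / gamma_function a.
Let h : RB -> R := gamma_density a b.

Let gamma_function_ge0 : 0 <= gamma_function a.
Proof.
by apply: Rintegral_ge0 => x _; rewrite mulr_ge0 ?powR_ge0 ?expR_ge0.
Qed.

Let K0 : 0 <= K. Proof. by rewrite mulr_ge0 ?powR_ge0 ?invr_ge0. Qed.

Let hE : h = (fun x => K * gamma_weight b a x) \_ D0.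
Proof.
apply/funext => x; rewrite patchE /h /gamma_density mem_setE/= in_itv/= andbT.
by case: ifP => // _; rewrite /K /gamma_weight !mulrA.
Qed.

Let mh : measurable_fun setT h.
Proof.
rewrite hE; apply/measurable_restrict => //.
rewrite setTI; apply: measurable_funM => //; exact: measurable_gamma_weight.
Qed.

Let h0 x : 0 <= h x.
Proof.
rewrite hE patchE; case: ifP => _; last exact: lexx.
exact: mulr_ge0 K0 (gamma_weight_ge0 _ _ _).
Qed.

(* [R] and [measurableTypeR R] have the same measurable sets but different displays;
   the Lebesgue measure lives on the latter. *)
Let mXB : measurable_fun setT (X : T -> RB).
Proof. exact: (measurable_funPT X). Qed.

Let XB : {mfun T >-> RB} := @mfun_Sub _ _ T RB (X : T -> RB) (mem_set mXB).

Let nu : probability RB R := distribution P XB.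

Let nuE A : measurable A -> nu A = (\int[leb]_(x in A) (h x)%:E)%E.
Proof. by move=> mA; exact: lawX. Qed.

Let integral_h (f : RB -> R) :
  (\int[leb]_x ((f x)%:E * (h x)%:E) = \int[leb]_(x in D0) (K * (f x * gamma_weight b a x))%:E)%E.
Proof.
rewrite [RHS]integral_mkcond; apply: eq_integral => x _.
by rewrite hE /= !patchE; case: ifP => _; rewrite ?mule0// -EFinM mulrCA.
Qed.

Let total : (\int[leb]_(x in D0) (K * gamma_weight b a x)%:E = 1)%E.
Proof.
have := nuE measurableT; rewrite probability_setT => ->.
by rewrite integral_mkcond; apply: eq_integral => x _; rewrite hE restrict_EFin.
Qed.

(** For a < 1 the bounds for parameters at least 1 say nothing of [gamma_function a]; were its
    integral infinite, [fine] and the inverse of 0 would give K = 0. The total mass 1 excludes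
    this. *)
Let Kgt0 : 0 < K.
Proof.
rewrite lt_neqAle K0 andbT; apply/eqP => K00.
have := total; rewrite integral0_eq => [/eqP|x _]; first by rewrite lt_eqF.
by rewrite -K00 mul0r.
Qed.

Lemma integrable_gamma_law_weight : leb.-integrable D0 (EFin \o gamma_weight b a).
Proof.
have mD : measurable D0 by [].
have iK : leb.-integrable D0 (EFin \o (fun x => K * gamma_weight b a x)).
  apply/integrableP; split.
    apply/measurable_EFinP; apply: measurable_funM => //.
    exact: measurable_gamma_weight.
  rewrite (eq_integral (fun x : RB => (K * gamma_weight b a x)%:E)) ?total ?ltry// => x _.
  by rewrite /= ger0_norm// mulr_ge0// gamma_weight_ge0.
have := integrableZl mD K^-1 iK.
by apply: eq_integrable => // x _ /=; rewrite -EFinM mulKf ?gt_eqF.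
Qed.

(** The factor x turns the weight of parameter a into that of parameter a + 1 >= 1, which is
    exponentially dominated even if a < 1. *)
Lemma integrable_gamma_law : P.-integrable setT (EFin \o X).
Proof.
apply/integrableP; split; first exact/measurable_EFinP.
have -> : (\int[P]_w `|(EFin \o X) w| = \int[nu]_x `|x|%:E)%E.
  rewrite /nu ge0_integral_distribution//.
  by apply/measurable_EFinP; exact: normr_measurable.
rewrite (ge0_integral_density mh nuE)//; last first.
  by apply/measurable_EFinP; exact: normr_measurable.
rewrite integral_h.
have a1 : 1 <= a + 1 by rewrite lerDr ltW.
have mD : measurable D0 by [].
have := integrableZl mD K (integrable_gamma_weight b0 a1).
move=> /integrableP[_]; apply: le_lt_trans; apply: ge0_le_integral => //.
- move=> x _; rewrite lee_fin; apply: mulr_ge0 => //.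
  by apply: mulr_ge0 => //; exact: gamma_weight_ge0.
- apply/measurable_EFinP; apply: measurable_funM => //.
  by apply: measurable_funM; [exact: normr_measurable|exact: measurable_gamma_weight].
- apply: measurableT_comp => //; apply/measurable_EFinP; apply: measurable_funM => //.
  exact: measurable_gamma_weight.
- move=> x; rewrite /= in_itv/= andbT => x0; rewrite lee_fin.
  by rewrite gamma_weightS// (gtr0_norm x0) ler_norm.
Qed.

Let expect (f : R -> R) : measurable_fun setT f ->
  P.-integrable setT (EFin \o (fun w => f (X w))) ->
  \int[P]_w f (X w) = \int[leb]_(x in D0) (K * (f x * gamma_weight b a x)).
Proof.
move=> mf intf; rewrite /Rintegral; congr fine.
have inu : nu.-integrable setT (EFin \o f).
  by apply: integrable_pushforward => //; exact/measurable_EFinP.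
rewrite -integral_h -(integral_density mh h0 nuE inu).
by rewrite /nu integral_distribution//; exact/measurable_EFinP.
Qed.

Lemma gamma_law_stein g : smooth_bounded g ->
  \int[P]_w (X w * (b * g (X w) - derive1 g (X w))) = a * \int[P]_w g (X w).
Proof.
move=> sg; have sg' := sb_derive sg.
have mX : measurable_fun setT X by [].
have sf : smooth_bounded (fun x => b * g x - derive1 g x).
  have := sb_lin (- 1) sg' (sbZ b sg).
  by congr smooth_bounded; apply/funext => x; rewrite mulN1r addrC.
have mD : measurable D0 by [].
have iX := integrable_gamma_law.
have iw := integrable_gamma_law_weight.
have iw1 : leb.-integrable D0 (EFin \o gamma_weight b (a + 1)).
  by apply: integrable_gamma_weight => //; rewrite lerDr ltW.
have iM f s : smooth_bounded f -> leb.-integrable D0 (EFin \o gamma_weight b s) ->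
    leb.-integrable D0 (EFin \o (fun x => f x * gamma_weight b s x)).
  move=> sf0; have [C HC] := sb_bounded sf0.
  apply: (@integrable_bounded_mul _ _ _ leb D0 mD f _ C) => //.
  by apply: measurable_funTS; exact: sb_measurable.
rewrite (@expect (fun x => x * (b * g x - derive1 g x))); last 2 first.
- by apply: measurable_funM => //; exact: sb_measurable.
- exact: (integrable_sbX mX iX sf).
rewrite (@expect g); [|exact: sb_measurable|exact: integrable_sb].
have E := gamma_weight_by_parts b0 a0 iw sg.
rewrite [RHS](_ : _ = K * (a * \int[leb]_(x in D0) (g x * gamma_weight b a x))); last first.
  by rewrite RintegralZl//; [ring|exact: iM].
rewrite -E -RintegralZl//; last exact: (iM (fun x => b * g x - derive1 g x)).
apply: eq_Rintegral => x; rewrite inE/= in_itv/= andbT => x0.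
by rewrite gamma_weightS//; ring.
Qed.

End gamma_law.

(** * A gamma variable plus an independent summand *)

Section independent_pair.
Context {R : realType} d (T : measurableType d) (P : probability T R).
Variables (X S : {RV P >-> R}).
Hypothesis indXS : forall A B : set R, measurable A -> measurable B ->
  P (X @^-1` A `&` S @^-1` B) = (P (X @^-1` A) * P (S @^-1` B))%E.

(** By independence the joint law agrees with the product measure on rectangles, hence
    everywhere. *)
Lemma integral_independent_pair (f : R * R -> R) : measurable_fun setT f ->
    P.-integrable setT (EFin \o (fun w => f (X w, S w))) ->
    (distribution P X \x distribution P S)%E.-integrable setT (EFin \o f) ->
  (\int[P]_w (f (X w, S w))%:E =
   \int[distribution P S]_s \int[distribution P X]_x (f (x, s))%:E)%E.
Proof.
move=> mf iP ip.
have mXS : measurable_fun setT (fun w => (X w, S w)) by exact: measurable_fun_pair.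
pose XS : {mfun T >-> (R * R)%type} := mfun_Sub (mem_set mXS).
have mF : measurable_fun setT (EFin \o f) by exact/measurable_EFinP.
rewrite -(@integral_distribution _ _ _ _ _ P XS (EFin \o f))//.
rewrite (eq_measure_integral (distribution P X \x distribution P S)%E); last first.
  move=> A mA _; apply/esym; apply: product_measure_unique mA => B C mB mC.
  exact: indXS.
exact/esym/(integral21_prod_meas1 ip).
Qed.

Variables (a b lam : R).
Hypotheses (a0 : 0 < a) (b0 : 0 < b) (lawX : has_gamma_law X a b).

Lemma independent_gamma_stein g : smooth_bounded g ->
  \int[P]_w (X w * (b * g (lam * X w + S w) - lam * derive1 g (lam * X w + S w))) =
  a * \int[P]_w g (lam * X w + S w).
Proof.
move=> sg; have sg' := sb_derive sg.
have iX := integrable_gamma_law a0 b0 lawX.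
have mX : measurable_fun setT X by [].
have mS : measurable_fun setT S by [].
have mXS : measurable_fun setT (fun w => lam * X w + S w).
  by apply: measurable_funD => //; exact: measurable_funM.
pose u x := b * g x - lam * derive1 g x.
have su : smooth_bounded u.
  have := sb_lin (- lam) sg' (sbZ b sg).
  by congr smooth_bounded; apply/funext => x; rewrite /u mulNr addrC.
have iu : P.-integrable setT (EFin \o (fun w => X w * u (lam * X w + S w))).
  have [C HC] := sb_bounded su.
  have := @integrable_bounded_mul _ _ _ P setT measurableT (fun w => u (lam * X w + S w)) X C.
  move=> /(_ (sb_comp_measurable su mXS) (fun w _ => HC _) iX).
  by apply: eq_integrable => // w _ /=; rewrite mulrC.
have ig := integrable_sb P mXS sg.
have iag : P.-integrable setT (EFin \o (fun w => a * g (lam * X w + S w))).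
  by have := integrableZl measurableT a ig.
(* Both sides are merged into one integrand, whose integral over the law of X vanishes for each
   fixed value s of S: this is the one-variable identity for x -> g(lam x + s). *)
apply/eqP; rewrite -subr_eq0 -RintegralZl// -RintegralB//; apply/eqP.
pose f (z : R * R) := z.1 * u (lam * z.1 + z.2) - a * g (lam * z.1 + z.2).
have ml : measurable_fun setT (fun z : R * R => lam * z.1 + z.2).
  by apply: measurable_funD => //; exact: measurable_funM.
have mf : measurable_fun setT f.
  apply: measurable_funB; apply: measurable_funM => //; exact: sb_comp_measurable.
have iuag : P.-integrable setT (EFin \o (fun w => f (X w, S w))).
  by have := integrableB measurableT iu iag.
rewrite /Rintegral (integral_independent_pair mf iuag); last first.
  have mid : measurable_fun setT (fun x : R => x) by exact: measurable_id.
  have i1 : (distribution P X).-integrable setT (EFin \o (fun x => x)).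
    by apply: integrable_pushforward => //; exact/measurable_EFinP.
  have i2 : (distribution P X).-integrable setT (EFin \o (fun=> 1)).
    exact: (integrable_sb (distribution P X) mid (sb_cst 1)).
  have i3 : (distribution P S).-integrable setT (EFin \o (fun=> 1)).
    exact: (integrable_sb (distribution P S) mid (sb_cst 1)).
  have [C HC] := sb_bounded su; have [C' HC'] := sb_bounded sg.
  have j1 := integrable_prod_bounded (sb_comp_measurable su ml) (fun z => HC _) i1 i3.
  have j2 := integrable_prod_bounded (sb_comp_measurable sg ml) (fun z => HC' _) i2 i3.
  have := integrableB measurableT j1 (integrableZl measurableT a j2).
  apply: eq_integrable => // z _; rewrite /f /=; congr EFin; ring.
rewrite (_ : (fun s => _) = cst 0%E) ?integral0//; apply/funext => s /=.
have sgs : smooth_bounded (fun x => g (lam * x + s)) by exact: sb_affine.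
have sus : smooth_bounded (fun x => u (lam * x + s)) by exact: sb_affine.
have is1 := integrable_sbX mX iX sus; have is2 := integrable_sb P mX sgs.
have is2' : P.-integrable setT (EFin \o (fun w => a * g (lam * X w + s))).
  by have := integrableZl measurableT a is2.
have ifs : P.-integrable setT (EFin \o (fun w => f (X w, s))).
  by have := integrableB measurableT is1 is2'.
rewrite integral_distribution//; last first.
  by apply/measurable_EFinP; exact: measurableT_comp.
rewrite -RintegralE// RintegralB// RintegralZl//.
rewrite -(gamma_law_stein a0 b0 lawX sgs); congr EFin; apply/eqP.
rewrite subr_eq0; apply/eqP; apply: eq_Rintegral => w _.
by rewrite derive1_affine//; exact: sb_derivable.
Qed.

End independent_pair.

(** * Independence of one variable from a combination of the others *)

Section independent_sum.
Context {R : realType} d (T : measurableType d) (P : probability T R) (I : finType).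
Variables (X : I -> {RV P >-> R}) (lam : I -> R).
Hypothesis indX : independent_RVs X.
Variable k : I.

Let preim (B : I -> set R) := \bigcap_(i in [set i | i != k]) (X i @^-1` B i).
(** A pi-system generating the sigma-algebra of the variables of index other than k. *)
Let G : set (set T) := [set E | exists2 B : I -> set R,
  (forall i, measurable (B i)) & E = preim B].

Let mpreim B : (forall i, measurable (B i)) -> measurable (preim B).
Proof.
move=> mB; apply: fin_bigcap_measurable => [|i _].
  exact: (finite_finpred (predC1 k)).
by rewrite -[X in measurable X]setTI; exact: measurable_funPT.
Qed.

Let indep_G A E : measurable A -> G E ->
  P (E `&` X k @^-1` A) = (P (X k @^-1` A) * P E)%E.
Proof.
move=> mA [B mB ->].
(* [preim] ignores the index [k], so the set at that index is free to become [A]. *)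
pose B' i := if i == k then A else B i.
have mB' i : measurable (B' i) by rewrite /B'; case: ifP.
have := indX [set: I]%SET mB'; rewrite (bigD1 k) ?inE//= => H.
have B'k : B' k = A by rewrite /B' eqxx.
rewrite B'k in H.
have E1 : \bigcap_(i in [set i | i \in [set: I]%SET]) (X i @^-1` B' i) =
    preim B `&` X k @^-1` A.
  apply/seteqP; split => [w Hw|w [Bw Aw] i _]; last first.
    rewrite /B'; case: ifPn => [/eqP -> //|ik]; exact: Bw.
  split; last by have := Hw k; rewrite B'k /= inE; exact.
  by move=> i /= /negbTE ik; have := Hw i; rewrite /B' ik /= inE; exact.
rewrite -E1 H; congr (_ * _)%E.
(* Independence of the subfamily without [k] identifies the remaining product with the probability
   of [preim B]. *)
have := indX [set~ k]%SET mB.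
rewrite (_ : [set i | i \in [set~ k]%SET] = [set i | i != k]); last first.
  by apply/seteqP; split => i /=; rewrite !inE.
rewrite -/(preim B) => ->.
apply: eq_big => [i|i]; first by rewrite !inE.
by rewrite inE /B' => /negbTE ->.
Qed.

Definition other_sum (w : T) : R := \sum_(i | i != k) lam i * X i w.

(** The finite measures E -> P(E and X_k in A) and E -> P(X_k in A) P(E) agree on [G], hence on the
    sigma-algebra it generates, for which [other_sum] is measurable. *)
Lemma independent_RVs_sum (A B : set R) : measurable A -> measurable B ->
  P (X k @^-1` A `&` other_sum @^-1` B) =
  (P (X k @^-1` A) * P (other_sum @^-1` B))%E.
Proof.
move=> mA mB.
have mXA : measurable (X k @^-1` A).
  by rewrite -[X in measurable X]setTI; exact: measurable_funPT.
have GT : G setT.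
  exists (fun=> setT) => //; rewrite /preim.
  by apply/esym/seteqP; split.
have GI : setI_closed G.
  move=> _ _ [B1 mB1 ->] [B2 mB2 ->]; exists (fun i => B1 i `&` B2 i) => [i|].
    exact: measurableI.
  rewrite /preim -bigcapI; apply: eq_bigcapr => i _; exact: preimage_setI.
have mX i : i != k -> measurable_fun setT (X i : g_sigma_algebraType G -> R).
  move=> ik _ C mC; rewrite setTI; apply: sub_sigma_algebra.
  exists (fun j => if j == i then C else setT) => [j|]; first by case: ifP.
  apply/seteqP; split => [w Cw j _|w]; first by case: eqP => // ->.
  by move=> /(_ i ik); rewrite /= eqxx.
have mS : measurable_fun setT (other_sum : g_sigma_algebraType G -> R).
  rewrite /other_sum; under eq_fun do rewrite big_mkcond/=.
  apply: measurable_sum => i; have [->|ik] := eqVneq i k; first by [].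
  by apply: measurable_funM => //; exact: mX.
pose r : {nonneg R} := NngNum (fine_ge0 (measure_ge0 P (X k @^-1` A))).
have rE : r%:num%:E = P (X k @^-1` A) by rewrite fineK// fin_num_measure.
rewrite setIC -rE.
apply: (@g_sigma_algebra_measure_unique _ _ _ G _ (fun=> setT) _ _
  (mrestr P mXA) (mscale r P) GI) => //.
- by move=> _ [C mC ->]; exact: mpreim.
- by rewrite -subTset => w _; exists 0%N.
- by move=> E GE; rewrite /= /mscale rE; exact: indep_G.
- by move=> n; rewrite (le_lt_trans (probability_le1 _ _)) ?ltry// setTI.
- by have := mS measurableT B mB; rewrite setTI.
Qed.

End independent_sum.

Section gamma_inv_theory.
Context {R : realType}.
Notation leb := (@lebesgue_measure R).
Notation D0 := (`]0, +oo[%classic : set (measurableTypeR R)).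
Variables (r lam s : R) (n : nat).
Hypotheses (r0 : 0 < r) (s1 : 1 <= s).

Lemma gamma_inv_cst : exists2 K : R, K != 0 &
  gamma_inv r lam n s (fun=> 1) = fun=> K.
Proof.
exists (\int[leb]_(x in D0) gamma_weight r s x).
  by rewrite gt_eqF// Rintegral_gamma_weight_gt0.
rewrite /gamma_inv.
have -> : gamma_op r lam s (fun=> 1) =
    fun=> \int[leb]_(x in D0) gamma_weight r s x.
  by apply/funext => x; apply: eq_Rintegral => y _; rewrite mul1r.
elim: n => //= k ->; apply/funext => x.
by rewrite /subDerive derive1_cst mulr0 subr0.
Qed.

Lemma op_comm_gamma_inv W : sb_operator W -> op_comm W (gamma_op r lam s) ->
  op_comm W (gamma_inv r lam n s).
Proof.
move=> oW WG f sf; rewrite /gamma_inv -WG//.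
rewrite (op_comm_iter n oW (sb_operator_subDerive _))//.
  by move=> g sg; exact: op_comm_subDerive.
exact: (op_sb (sb_operator_gamma lam r0 s1)).
Qed.

Lemma op_comm_shift_gamma_inv b :
  op_comm (fun f x => f (x + b)) (gamma_inv r lam n s).
Proof.
apply: op_comm_gamma_inv; first exact: sb_operator_shift.
move=> f sf; apply/funext => x; apply: eq_Rintegral => y _.
by rewrite !mul1r addrAC.
Qed.

(** Both averages superpose translations, so Fubini exchanges them; the gamma weight is first
    extended by 0 to the whole line. *)
Lemma op_comm_avg_gamma_inv d (T : measurableType d) (P : probability T R)
    (X : T -> R) : measurable_fun setT X ->
  op_comm (avg P setT (fun=> 1) X (fun=> 1)) (gamma_inv r lam n s).
Proof.
move=> mX; have i1 := integrable_sb P mX (sb_cst 1).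
apply: op_comm_gamma_inv; first exact: sb_operator_avg.
have -> : gamma_op r lam s =
    avg leb setT (fun=> 1) (fun y => lam * y) (gamma_weight r s \_ D0).
  by apply/funext => f; apply/funext => x; rewrite /gamma_op avg_restrict.
apply: avg_comm => //; first exact: measurable_funM.
have := integrable_gamma_weight r0 s1.
rewrite -[X in leb.-integrable X _ -> _]setTI.
by move=> /integrable_restrict; rewrite restrict_EFin; apply.
Qed.

End gamma_inv_theory.

(** * The combination F satisfies the Stein identity *)

Section gamma_combination.
Context {R : realType} d (T : measurableType d) (P : probability T R) (I : finType).
Variables (X : I -> {RV P >-> R}) (a mu lam : I -> R).
Hypotheses (a0 : forall i, 0 < a i) (mu0 : forall i, 0 < mu i).
Hypothesis lawX : forall i, has_gamma_law (X i) (a i) (mu i).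
Hypothesis indX : independent_RVs X.
Let c i := lam i / mu i.
Let F w := \sum_i lam i * X i w.

Lemma measurable_gamma_combination : measurable_fun setT F.
Proof. by apply: measurable_sum => i; exact: measurable_funM. Qed.

Lemma integrable_gamma_combination : P.-integrable setT (EFin \o F).
Proof.
have iX i : P.-integrable setT (EFin \o (fun w => lam i * X i w)).
  by have := integrableZl measurableT (lam i) (integrable_gamma_law (a0 i) (mu0 i) (lawX i)).
have := @integrable_sum _ _ _ P setT measurableT _ (index_enum I) xpredT
  (fun i w => (lam i * X i w)%:E) (fun i _ => iX i).
by apply: eq_integrable => // w _; rewrite /= sumEFin.
Qed.

Lemma subDerives_rem (s : seq I) k f : uniq s -> k \in s -> smooth_bounded f ->
  subDerives c s f = subDerive (c k) (subDerives c (rem k s) f).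
Proof.
elim: s => //= j s IH /andP[js us]; rewrite inE; have [->//|kj /= ks] := eqVneq k j.
move=> sf; rewrite IH// op_comm_subDerive//; first exact: sb_operator_subDerive.
exact: (op_sb (sb_operator_subDerives c _)).
Qed.

(** F is lambda_k X_k plus an independent sum. The identity for X_k with test function P_k phi
    yields the k-th term, since mu_k (1 - c_k D) = mu_k - lambda_k D. *)
Lemma gamma_combination_stein : stein_identity c a (enum I) P F.
Proof.
move=> phi sp; set s := enum I.
have mF := measurable_gamma_combination.
have sR k : smooth_bounded (subDerives c (rem k s) phi).
  exact: (op_sb (sb_operator_subDerives c _)).
have sS : smooth_bounded (subDerives c s phi).
  exact: (op_sb (sb_operator_subDerives c _)).
have iU k : P.-integrable setT (EFin \o (fun w => X k w * subDerives c s phi (F w))).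
  have [C HC] := sb_bounded sS; have iX := integrable_gamma_law (a0 k) (mu0 k) (lawX k).
  have := integrable_bounded_mul measurableT (sb_comp_measurable sS mF)
    (fun w _ => HC (F w)) iX.
  by apply: eq_integrable => // w _ /=; rewrite mulrC.
have iXS k : P.-integrable setT
    (EFin \o (fun w => lam k * (X k w * subDerives c s phi (F w)))).
  by have := integrableZl measurableT (lam k) (iU k).
have -> : \int[P]_w (F w * subDerives c s phi (F w)) =
    \int[P]_w (\sum_i lam i * (X i w * subDerives c s phi (F w))).
  by apply: eq_Rintegral => w _; rewrite mulr_suml; under eq_bigr do rewrite -mulrA.
rewrite Rintegral_sum// /s big_enum; apply: eq_bigr => k _.
rewrite RintegralZl//.
have mS : measurable_fun setT (other_sum X lam k).
  rewrite /other_sum; under eq_fun do rewrite big_mkcond/=.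
  by apply: measurable_sum => i; case: (i != k) => //; exact: measurable_funM.
pose S : {RV P >-> R} := @mfun_Sub _ _ T R (other_sum X lam k) (mem_set mS).
have indS A B : measurable A -> measurable B ->
    P (X k @^-1` A `&` S @^-1` B) = (P (X k @^-1` A) * P (S @^-1` B))%E.
  exact: independent_RVs_sum.
have E := @independent_gamma_stein _ _ _ P (X k) S indS (a k) (mu k) (lam k)
  (a0 k) (mu0 k) (lawX k) _ (sR k).
have FE w : lam k * X k w + S w = F w by rewrite /F (bigD1 k).
have muk : mu k != 0 by rewrite gt_eqF.
have ks : k \in s by rewrite mem_enum.
rewrite (_ : \int[P]_w subDerives c (rem k s) phi (F w) =
  \int[P]_w subDerives c (rem k s) phi (lam k * X k w + S w)); last first.
  by apply: eq_Rintegral => w _; rewrite FE.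
rewrite mulrAC -E.
rewrite [X in _ = X * _](_ : _ = mu k * \int[P]_w (X k w * subDerives c s phi (F w))).
  by rewrite /c; field.
rewrite -RintegralZl//; apply: eq_Rintegral => w _.
by rewrite FE (subDerives_rem (enum_uniq _) ks sp) -/s /subDerive /c; field.
Qed.

End gamma_combination.

(** * Coefficients of the Stein operator *)

Section coefficients.
Context {R : realType}.
Implicit Types (f : R -> R) (p : {poly R}).

(** Vieta's formula: the product is expanded over subsets of the indices, and those with k elements
    give the coefficient. *)
Lemma coef_prod_elem_sym n (x : 'I_n -> R) k :
  (\prod_(i < n) (1 - x i *: 'X))`_k = (-1) ^+ k * elem_sym k x.
Proof.
have -> : elem_sym k x = \sum_(h : {set 'I_n} | #|h| == k) \prod_(i in h) x i.
  rewrite /elem_sym /mpoly.mesym.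
  rewrite (big_morph _ (mpoly.mevalD x) (mpoly.meval0 x)); apply: eq_bigr => h _.
  rewrite (big_morph _ (mpoly.mevalM x) (mpoly.meval1 x)).
  by apply: eq_bigr => i _; rewrite mpoly.mevalXU.
under eq_bigr do rewrite addrC.
rewrite bigA_distr/= coef_sum mulr_sumr [RHS]big_mkcond/=.
apply: eq_bigr => h _.
have -> : \prod_i (if i \in h then - (x i *: 'X) else 1) =
    ((-1) ^+ #|h| * \prod_(i in h) x i) *: 'X^#|h| :> {poly R}.
  rewrite -big_mkcond/= (eq_bigr (fun i => (- x i) *: 'X)) => [|i _]; last by rewrite scaleNr.
  by rewrite scaler_prod prodr_const prodrN.
rewrite coefZ coefXn eq_sym; case: eqP => [<-|_]; last by rewrite mulr0.
by rewrite mulr1.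
Qed.

Lemma size_prod_subDerive (I : Type) (s : seq I) (x : I -> R) :
  (size (\prod_(i <- s) (1 - x i *: 'X) : {poly R})%R <= (size s).+1)%N.
Proof.
elim: s => [|i s IH]; first by rewrite big_nil size_poly1.
rewrite big_cons mulrBl mul1r -scalerAl mulrC.
rewrite (leq_trans (size_polyD _ _))// geq_max (leq_trans IH)//= size_polyN.
rewrite (leq_trans (size_scale_leq _ _))// (leq_trans (size_polyMleq _ _))//.
by rewrite size_polyX addn2.
Qed.

Definition poly_derive p f (y : R) := \sum_(i < size p) p`_i * derive1n i f y.

Lemma poly_deriveE N p f y : (size p <= N)%N ->
  poly_derive p f y = \sum_(i < N) p`_i * derive1n i f y.
Proof.
move=> pN; rewrite /poly_derive (big_ord_widen N (fun i => p`_i * derive1n i f y))//.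
rewrite big_mkcond/=; apply: eq_bigr => i _; case: ltnP => // pi.
by rewrite nth_default// mul0r.
Qed.

Lemma subDerives_poly (I : eqType) (c : I -> R) s f y : smooth_bounded f ->
  subDerives c s f y = poly_derive (\prod_(j <- s) (1 - c j *: 'X)) f y.
Proof.
elim: s f y => [|j s IH] f y sf.
  by rewrite big_nil (@poly_deriveE 1) ?size_poly1// big_ord1 coef1 mul1r.
rewrite /= -/(subDerives c s) -(op_comm_subDerive (c j) (sb_operator_subDerives c s) sf).
rewrite IH; last exact: (op_sb (sb_operator_subDerive _)).
set p := \prod_(j <- s) _.
rewrite big_cons -/p (@poly_deriveE (size p).+1) ?leqnSn//.
rewrite (@poly_deriveE (size p).+1); last first.
  rewrite mulrBl mul1r -scalerAl mulrC.
  rewrite (leq_trans (size_polyD _ _))// geq_max leqnSn/= size_polyN.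
  rewrite (leq_trans (size_scale_leq _ _))// (leq_trans (size_polyMleq _ _))//.
  by rewrite size_polyX addn2.
under eq_bigr => i _.
  rewrite (subDeriveE) derive1n_lin//; last exact: sb_derive.
  rewrite -derive1Sn mulrDr mulNr mulrN mulrCA. over.
rewrite big_split/= sumrN.
under [RHS]eq_bigr => i _.
  rewrite mulrBl mul1r -scalerAl coefB coefZ coefXM mulrBl. over.
rewrite sumrB addrC; congr (_ - _).
rewrite big_ord_recr/= nth_default// mul0r mulr0 addr0.
rewrite [RHS]big_ord_recl/= mulr0 mul0r add0r.
by apply: eq_bigr => i _; rewrite mulrA.
Qed.

(** Multiplied by 1 - x_k X both sides become the full product; this factor has constant coefficient
    1, so it is nonzero and cancels. *)
Lemma prod_rem_lift n (x : 'I_n -> R) (k : 'I_n) :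
  \prod_(j <- rem k (enum 'I_n)) (1 - x j *: 'X) =
  \prod_(i < n.-1) (1 - omit x k i *: 'X).
Proof.
have nz : 1 - x k *: 'X != 0 :> {poly R}.
  apply/eqP => /(congr1 (fun p => p`_0)).
  by rewrite coefB coefZ coefX mulr0 subr0 coef1 coef0 => /eqP; rewrite oner_eq0.
apply: (mulfI nz).
have -> : (1 - x k *: 'X) * \prod_(j <- rem k (enum 'I_n)) (1 - x j *: 'X) =
    \prod_(j <- enum 'I_n) (1 - x j *: 'X).
  by rewrite [RHS](big_rem k) ?mem_enum.
by rewrite big_enum/= (@bigD1_ord _ _ _ n k xpredT).
Qed.

End coefficients.

Section stein_expansion.
Context {R : realType} (d : nat) (hd : (1 <= d)%N) (c b : 'I_d -> R).
Implicit Types (phi : R -> R) (y : R).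
Let s := enum 'I_d.
Let M := \sum_i b i.

Lemma elem_sym0 n (x : 'I_n -> R) : elem_sym 0 x = 1.
Proof. by rewrite /elem_sym mpoly.mesym0E mpoly.meval1. Qed.

Lemma elem_symnn n (x : 'I_n -> R) : elem_sym n x = \prod_i x i.
Proof.
rewrite /elem_sym mpoly.mesymnnE (big_morph _ (mpoly.mevalM x) (mpoly.meval1 x)).
by apply: eq_bigr => i _; rewrite mpoly.mevalXU.
Qed.

Lemma elem_sym_gt n k (x : 'I_n -> R) : (n < k)%N -> elem_sym k x = 0.
Proof. by move=> nk; rewrite /elem_sym mpoly.mesym_geqnE// mpoly.meval0. Qed.

(** With b_k = a_k c_k, M is the mean of the uncentred variable, and this is the integrand of the
    theorem in factored form. *)
Definition stein_op phi y := (y + M) * subDerives c s phi y -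
  \sum_k b k * subDerives c (rem k s) phi y.

(** Exhibits coefficients affine in y, the form used by [schwartz_extension]. *)
Lemma stein_op_sum phi y : smooth_bounded phi -> stein_op phi y =
  \sum_(0 <= l < d.+1) ((-1) ^+ l * elem_sym l c * y +
    ((-1) ^+ l * elem_sym l c * M - \sum_k b k * ((-1) ^+ l * elem_sym l (omit c k)))) *
      derive1n l phi y.
Proof.
move=> sp; rewrite /stein_op subDerives_poly// (@poly_deriveE _ d.+1); last first.
  by rewrite (leq_trans (size_prod_subDerive _ _))// size_enum_ord.
rewrite (eq_bigr (fun k => \sum_(l < d.+1)
  b k * ((-1) ^+ l * elem_sym l (omit c k)) * derive1n l phi y)); last first.
  move=> k _; rewrite subDerives_poly// (@poly_deriveE _ d.+1); last first.
    rewrite (leq_trans (size_prod_subDerive _ _))// size_rem ?mem_enum//.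
    by rewrite size_enum_ord prednK// leqnSn.
  rewrite mulr_sumr; apply: eq_bigr => l _.
  by rewrite prod_rem_lift coef_prod_elem_sym mulrA.
rewrite exchange_big/= mulr_sumr -sumrB big_mkord; apply: eq_bigr => l _.
rewrite /s big_enum/= coef_prod_elem_sym -mulr_suml.
rewrite mulrA -mulrBl; congr (_ * _); ring.
Qed.

(** Only the extreme orders look different. At l = 0 every e_0 is 1 and the two occurrences of M
    cancel, leaving y phi; at l = d the tuple with one entry omitted has e_d = 0, so M stays. *)
Lemma stein_expansion phi y : smooth_bounded phi ->
  (y + M) * (-1) ^+ d * (\prod_(j < d) c j) * derive1n d phi y
  + \sum_(1 <= l < d) (-1) ^+ l *
      (y * elem_sym l c + \sum_(k < d) b k * (elem_sym l c - elem_sym l (omit c k)))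
      * derive1n l phi y
  + y * phi y = stein_op phi y.
Proof.
move=> sp; rewrite stein_op_sum// big_nat_recr// big_ltn//.
have E l : \sum_k b k * ((-1) ^+ l * elem_sym l (omit c k)) =
    (-1) ^+ l * \sum_k b k * elem_sym l (omit c k).
  by rewrite mulr_sumr; apply: eq_bigr => k _; rewrite mulrCA.
have B0 : \sum_k b k * elem_sym 0 (omit c k) = M.
  by apply: eq_bigr => k _; rewrite elem_sym0 mulr1.
have Bd : \sum_k b k * elem_sym d (omit c k) = 0.
  by apply: big1 => k _; rewrite elem_sym_gt ?mulr0// prednK.
rewrite !E B0 Bd elem_sym0 elem_symnn expr0.
rewrite (eq_bigr (fun l => ((-1) ^+ l * elem_sym l c * y +
    ((-1) ^+ l * elem_sym l c * M - \sum_k b k * ((-1) ^+ l * elem_sym l (omit c k)))) *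
    derive1n l phi y)); first by rewrite /=; ring.
move=> l _; rewrite E; congr (_ * _).
have -> : \sum_k b k * (elem_sym l c - elem_sym l (omit c k)) =
    elem_sym l c * M - \sum_k b k * elem_sym l (omit c k).
  rewrite mulr_sumr -sumrB; apply: eq_bigr => k _; ring.
ring.
Qed.

End stein_expansion.

(** * From Schwartz to smooth bounded test functions *)

Section schwartz_extension.
Context {R : realType} d (T : measurableType d) (P : probability T R).
Variable Y : T -> R.
Hypothesis mY : measurable_fun setT Y.
Hypothesis iY : P.-integrable setT (EFin \o Y).
Variables (N : nat) (A B : nat -> R).

Let L phi y := \sum_(0 <= l < N) (A l * y + B l) * derive1n l phi y.

(** The cut-offs have derivatives bounded uniformly in n and the coefficients are affine in Y, so
    the first moment of Y supplies the dominating function. *)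
Lemma schwartz_extension :
  (forall phi, schwartz phi -> (\int[P]_w (L phi (Y w))%:E = 0)%E) ->
  forall phi, smooth_bounded phi -> (\int[P]_w (L phi (Y w))%:E = 0)%E.
Proof.
move=> H phi sp; have [f [sf Hf]] := schwartz_approx sp.
have [C HC] := choice (fun l => (Hf l).1).
have mL g : smooth_bounded g -> measurable_fun setT (fun w => L g (Y w)).
  move=> sg; apply: measurable_sum => l; apply: measurable_funM.
    by apply: measurable_funD => //; exact: measurable_funM.
  by apply: sb_comp_measurable => //; exact: sb_deriven.
have C0 l : 0 <= C l by rewrite (le_trans _ (HC l 0%N 0)).
have [|||||_ _ cvg] := @dominated_convergence _ _ _ P setT measurableT
  (fun n w => (L (f n) (Y w))%:E) (fun w => (L phi (Y w))%:E)
  (fun w => (\sum_(0 <= l < N) (`|A l| * `|Y w| + `|B l|) * C l)%:E).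
- move=> n; apply/measurable_EFinP; apply: mL.
  exact: schwartz_smooth_bounded.
- by apply/measurable_EFinP; exact: mL.
- apply: aeW => w _; apply: cvg_EFin; first exact: nearW.
  rewrite /L; elim: (index_iota 0 N) => [|l t IH].
    by under eq_fun do rewrite big_nil; rewrite big_nil; exact: cvg_cst.
  under eq_fun do rewrite big_cons; rewrite big_cons; apply: cvgD => //.
  by apply: cvgM; [exact: cvg_cst|exact: (Hf l).2].
- have iterm l : P.-integrable setT (fun w => ((`|A l| * `|Y w| + `|B l|) * C l)%:E).
    have i1 := integrableZl measurableT (C l * `|A l|) (integrable_norm iY).
    have i2 := integrable_sb P mY (sb_cst (C l * `|B l|)).
    apply: eq_integrable (integrableD measurableT i1 i2) => // w _ /=.
    congr EFin; ring.
  have := @integrable_sum _ _ _ P setT measurableT _ (index_iota 0 N) xpredT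
    (fun l w => ((`|A l| * `|Y w| + `|B l|) * C l)%:E) (fun l _ => iterm l).
  by apply: eq_integrable => // w _; rewrite /= sumEFin.
- apply: aeW => w n _; rewrite lee_fin (le_trans (ler_norm_sum _ _ _))//.
  apply: ler_sum => l _; rewrite normrM ler_pM//.
  by rewrite (le_trans (ler_normD _ _))// normrM.
have cvg0 : (\int[P]_w (L (f n) (Y w))%:E @[n --> \oo] --> 0)%E.
  by under eq_fun do rewrite H//; exact: cvg_cst.
exact: (cvg_unique _ cvg cvg0).
Qed.

End schwartz_extension.

(** * Centring *)

Section stein_shift.
Context {R : realType} d (T : measurableType d) (P : probability T R).
Variables (n : nat) (c a b : 'I_n -> R).
Hypothesis bE : forall i, b i = a i * c i.
Variable X : T -> R.
Hypothesis mX : measurable_fun setT X.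
Hypothesis iX : P.-integrable setT (EFin \o X).
Let s := enum 'I_n.
Let M := \sum_i b i.

Lemma integrable_shift : P.-integrable setT (EFin \o (fun w => X w + M)).
Proof.
by have := integrableD measurableT iX (integrable_sb P mX (sb_cst M)).
Qed.

Lemma stein_op_integrable phi : smooth_bounded phi ->
  P.-integrable setT (EFin \o (fun w => stein_op c b phi (X w))).
Proof.
move=> sp.
have sS : smooth_bounded (subDerives c s phi) by exact: (op_sb (sb_operator_subDerives _ _)).
have sR : smooth_bounded (fun y => \sum_k b k * subDerives c (rem k s) phi y).
  by apply: sb_sum => k; apply: sbZ; exact: (op_sb (sb_operator_subDerives _ _)).
have i1 := integrableD measurableT (integrable_sbX mX iX sS) (integrable_sb P mX (sbZ M sS)).
have := integrableB measurableT i1 (integrable_sb P mX sR).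
by apply: eq_integrable => // w _; rewrite /stein_op /= mulrDl.
Qed.

(** The test functions are stable under translation and the operators commute with it, so phi is
    exchanged for its translate by -M or M. *)
Lemma stein_identity_shift : stein_identity c a s P (fun w => X w + M) <->
  forall phi, smooth_bounded phi -> (\int[P]_w (stein_op c b phi (X w))%:E = 0)%E.
Proof.
have intE phi : smooth_bounded phi -> (\int[P]_w (stein_op c b phi (X w))%:E =
    (\int[P]_w ((X w + M) * subDerives c s phi (X w)) -
     \sum_(k <- s) a k * c k * \int[P]_w subDerives c (rem k s) phi (X w))%:E)%E.
  move=> sp.
  have sS : smooth_bounded (subDerives c s phi) by exact: (op_sb (sb_operator_subDerives _ _)).
  have sR k : smooth_bounded (subDerives c (rem k s) phi).
    exact: (op_sb (sb_operator_subDerives _ _)).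
  have iS : P.-integrable setT (EFin \o (fun w => (X w + M) * subDerives c s phi (X w))).
    have := integrableD measurableT (integrable_sbX mX iX sS) (integrable_sb P mX (sbZ M sS)).
    by apply: eq_integrable => // w _; rewrite /= mulrDl.
  have iR k : P.-integrable setT (EFin \o (fun w => a k * c k * subDerives c (rem k s) phi (X w))).
    exact: (integrable_sb P mX (sbZ _ (sR k))).
  have ssR : smooth_bounded (fun y => \sum_(k <- s) a k * c k * subDerives c (rem k s) phi y).
    by apply: sb_sum => k; exact: sbZ.
  have isR := integrable_sb P mX ssR.
  rewrite -RintegralE ?stein_op_integrable//; congr EFin.
  under [X in _ = _ - X]eq_bigr => k _.
    rewrite -RintegralZl//; last exact: integrable_sb.
    over.
  rewrite -Rintegral_sum// -RintegralB//; apply: eq_Rintegral => w _.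
  rewrite /stein_op /s big_enum; congr (_ - _); apply: eq_bigr => k _.
  by rewrite bE.
have shift t f y : smooth_bounded f ->
    subDerives c t (fun x => f (x + - M)) (y + M) = subDerives c t f y.
  by move=> sf; rewrite -(op_comm_subDerives c t (sb_operator_shift (- M)) sf) addrK.
have shift' t f y : smooth_bounded f ->
    subDerives c t (fun x => f (x + M)) y = subDerives c t f (y + M).
  by move=> sf; rewrite -(op_comm_subDerives c t (sb_operator_shift M) sf).
split=> [H phi sp|H phi sp].
  have := H _ (sb_shift (- M) sp); rewrite intE// => E.
  congr EFin; apply/eqP; rewrite subr_eq0; apply/eqP.
  under eq_Rintegral do rewrite -shift//.
  rewrite E; apply: eq_bigr => k _; congr (_ * _).
  by apply: eq_Rintegral => w _; rewrite shift.
have := H _ (sb_shift M sp).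
rewrite intE; last exact: sb_shift.
move=> -[] /eqP.
rewrite subr_eq0 => /eqP E.
under eq_Rintegral do rewrite -shift'//.
rewrite E; apply: eq_bigr => k _; congr (_ * _).
by apply: eq_Rintegral => w _; rewrite shift'.
Qed.

End stein_shift.

Theorem theorem2p1 (R : realType) (d : nat) (hd : (1 <= d)%N)
    (m : 'I_d -> nat) (hm : forall i, (0 < m i)%N)
    (alpha mu lambda : 'I_d -> R)
    (halpha : forall i, 0 < alpha i) (hmu : forall i, 0 < mu i)
    (hlambda : forall i, lambda i != 0)
    (dispF : measure_display) (TF : measurableType dispF)
    (PF : probability TF R) (gam : 'I_d -> {RV PF >-> R})
    (hgam : forall i, has_gamma_law (gam i) ((m i)%:R * alpha i) (mu i))
    (hindep : independent_RVs gam)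
    (F : {RV PF >-> R})
    (hF : forall w, F w = - (\sum_(i < d) lambda i * ((m i)%:R * alpha i / mu i))
                          + \sum_(i < d) lambda i * gam i w)
    (dispY : measure_display) (TY : measurableType dispY)
    (PY : probability TY R) (Y : {RV PY >-> R})
    (hY : ('E_PY[fun w => `|Y w|%R] < +oo)%E) :
  same_law Y F <->
  (forall phi : R -> R, schwartz phi ->
    ('E_PY[fun w =>
       ((Y w + \sum_(i < d) lambda i * ((m i)%:R * alpha i / mu i))
          * (-1) ^+ d * (\prod_(j < d) (lambda j / mu j)) * derive1n d phi (Y w)
        + \sum_(1 <= l < d)
            (-1) ^+ l
            * (Y w * elem_sym l (fun i => lambda i / mu i)
               + \sum_(k < d) lambda k * ((m k)%:R * alpha k / mu k)
                   * (elem_sym l (fun i => lambda i / mu i)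
                      - elem_sym l (omit (fun i => lambda i / mu i) k)))
            * derive1n l phi (Y w)
        + Y w * phi (Y w))%R] = 0)%E).
Proof.
pose c i := lambda i / mu i; pose a i := (m i)%:R * alpha i.
pose b i := lambda i * (a i / mu i); pose M := \sum_i b i.
have bE i : b i = a i * c i by rewrite /b /c mulrCA.
have a0 i : 0 < a i by rewrite mulr_gt0// ltr0n.
have mY : measurable_fun setT Y by [].
have mF : measurable_fun setT F by [].
have iY : PY.-integrable setT (EFin \o Y).
  by apply/integrableP; split; [exact/measurable_EFinP|move: hY; rewrite unlock].
pose F' w := \sum_i lambda i * gam i w.
have FE w : F w + M = F' w by rewrite hF addrC addNKr.
have mF' : measurable_fun setT F' by exact: measurable_gamma_combination.
have iF' : PF.-integrable setT (EFin \o F').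
  exact: (integrable_gamma_combination lambda a0 hmu hgam).
have iF : PF.-integrable setT (EFin \o F).
  have := integrableD measurableT iF' (integrable_sb PF mF' (sb_cst (- M))).
  by apply: eq_integrable => // w _; rewrite /= -EFinD -FE; congr EFin; ring.
have steinF' : stein_identity c a (enum 'I_d) PF F'.
  exact: (gamma_combination_stein lambda a0 hmu hgam hindep).
have steinF : forall phi, smooth_bounded phi ->
    (\int[PF]_w (stein_op c b phi (F w))%:E = 0)%E.
  apply/(stein_identity_shift bE mF iF).
  by rewrite (_ : (fun w => _) = F')//; apply/funext => w; rewrite FE.
have EE phi : schwartz phi -> ('E_PY[fun w => (
    (Y w + M) * (-1) ^+ d * (\prod_(j < d) c j) * derive1n d phi (Y w)
    + \sum_(1 <= l < d) (-1) ^+ l *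
      (Y w * elem_sym l c + \sum_(k < d) b k * (elem_sym l c - elem_sym l (omit c k)))
      * derive1n l phi (Y w)
    + Y w * phi (Y w))%R] = \int[PY]_w (stein_op c b phi (Y w))%:E)%E.
  move=> sphi; rewrite unlock; apply: eq_integral => w _.
  by rewrite stein_expansion//; exact: schwartz_smooth_bounded.
split=> [lawYF phi sphi|H].
  rewrite EE//; have sp := schwartz_smooth_bounded sphi.
  rewrite -(steinF _ sp).
  have mop : measurable_fun setT (fun y => (stein_op c b phi y)%:E).
    have sS t : smooth_bounded (subDerives c t phi).
      exact: (op_sb (sb_operator_subDerives _ _)).
    apply/measurable_EFinP; apply: measurable_funB.
      by apply: measurable_funM; [exact: measurable_funD|exact: sb_measurable].
    by apply: sb_measurable; apply: sb_sum => k; exact: sbZ.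
  rewrite -(@integral_distribution _ _ _ _ _ PY Y _ mop); last exact: stein_op_integrable.
  rewrite -(@integral_distribution _ _ _ _ _ PF F _ mop); last exact: stein_op_integrable.
  by apply: eq_measure_integral => A mA _; exact: lawYF.
have steinY : stein_identity c a (enum 'I_d) PY (fun w => Y w + M).
  apply/(stein_identity_shift bE mY iY) => phi sp.
  have := @schwartz_extension _ _ _ PY Y mY iY d.+1
    (fun l => (-1) ^+ l * elem_sym l c)
    (fun l => (-1) ^+ l * elem_sym l c * M - \sum_k b k * ((-1) ^+ l * elem_sym l (omit c k))).
  move=> ext; rewrite -[RHS](ext _ phi sp).
    by apply: eq_integral => w _; rewrite stein_op_sum.
  move=> psi spsi; rewrite -(H _ spsi) EE//; apply: eq_integral => w _.
  by rewrite stein_op_sum//; exact: schwartz_smooth_bounded.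
(* n > a, so s = n + 1 - a exceeds 1, and n + 1 - s gives back the coefficient a in
   [twisted_gamma_inv]. *)
pose n i := (Num.truncn (a i)).+1; pose s i := (n i).+1%:R - a i.
have s1 i : 1 <= s i.
  by rewrite lerBrDr addrC -natr1 lerD2r ltW// /n truncnS_gt.
have as_ i : (n i).+1%:R - s i = a i by rewrite opprB addrC subrK.
pose V i := gamma_inv (mu i) (lambda i) (n i) (s i).
have tV i : twisted (subDerive (c i) \o V i) (V i) (a i * c i).
  by rewrite -as_; exact: twisted_gamma_inv.
have oV i : sb_operator (V i) by exact: sb_operator_gamma_inv.
have V1 i : exists2 K : R, K != 0 & V i (fun=> 1) = fun=> K by exact: gamma_inv_cst.
have shiftV t i : op_comm (fun f x => f (x + t)) (V i).
  exact: op_comm_shift_gamma_inv.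
have avgV i : op_comm (avg PF setT (fun=> 1) F' (fun=> 1)) (V i).
  exact: op_comm_avg_gamma_inv.
have mYM : measurable_fun setT (fun w => Y w + M) by exact: measurable_funD.
have iYM := integrable_shift b mY iY.
apply: same_lawP => h sh.
(* Uniqueness compares the uncentred variables Y + M and F', so h is translated by -M. *)
have := stein_unique (enum_uniq _) oV tV V1 shiftV mYM mF' iYM iF' steinY steinF'
  avgV (sb_shift (- M) sh).
under eq_Rintegral do rewrite addrK.
by under [RHS]eq_Rintegral do rewrite -FE addrK.
Qed.
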